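(* Let $(S,\mu)$ be a probability space. Let $L$ be the generator on $L^2(\mu)$, either of a strongly continuous Markov semigroup $(P_t)_{t\ge0}$ with invariant measure $\mu$ (continuous time), or of the form $L=P-I$ for a discrete-time Markov chain with Markov transition kernel $P$ with invariant measure $\mu$ (discrete time). Let $K\subset L^2_0(\mu)$ be a closed subspace such that $P_t(K)\subset K$ for all $t\ge0$ in continuous time, or $P(K)\subset K$ in discrete time. Let $L_K$ denote the generator restricted to $K$, and suppose that $$\gamma_K:=\inf_{f\in\operatorname{Dom}(L_K)\setminus\{0\}}\frac{\|L_Kf\|}{\|f\|}>0.$$ Then $L_K$ is invertible (i.e. $L_K:\operatorname{Dom}(L_K)\to K$ is a bijection with bounded inverse) and $$\|L_K^{-1}\|_{K\to K}\le\frac1{\gamma_K}.$$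
   Context: $L^2(\mu)$ is the space of complex-valued square-integrable functions with norm $\|\cdot\|$, and $L^2_0(\mu)=\{g\in L^2(\mu):\int g\,d\mu=0\}$. In continuous time, $P_tg(x)=\mathbb E_x[g(X_t)]$ for a time-homogeneous Markov process, $Lg=\lim_{t\downarrow0}(P_tg-g)/t$ with domain $\operatorname{Dom}(L)$ the set of $g\in L^2(\mu)$ for which the limit exists in $L^2(\mu)$. In discrete time, $Pg(x)=\int g(y)\,P(x,dy)$ and $\operatorname{Dom}(L)=L^2(\mu)$. $L_K$ is $L$ restricted to $\operatorname{Dom}(L_K)=\operatorname{Dom}(L)\cap K$, equivalently the generator of the restricted semigroup $(P_t|_K)$ (respectively $P|_K-I$). Convention: $\inf\emptyset=+\infty$, $1/\infty=0$. *)

(* Defs.v *)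
From HB Require Import structures.
From mathcomp Require Import all_boot all_order all_algebra.
From mathcomp Require Import ring_quotient generic_quotient.
From mathcomp Require Import all_classical all_reals all_analysis.
From mathcomp Require Import measurable_realfun hoelder kernel complex.

Set Implicit Arguments.
Unset Strict Implicit.
Unset Printing Implicit Defensive.

Import Order.TTheory GRing.Theory Num.Theory.
Import numFieldNormedType.Exports.
Import ComplexField.Normc.

Local Open Scope classical_set_scope.
Local Open Scope ring_scope.
Local Open Scope complex_scope.
Local Open Scope quotient_scope.

Section L2fun.
Context d (S : measurableType d) (R : realType).
Implicit Types f g : S -> R[i].

Definition cmeasurable f :=
  measurable_fun setT (fun x => complex.Re (f x)) /\
  measurable_fun setT (fun x => complex.Im (f x)).

Lemma normcE2 (z : R[i]) :
  normc z = Num.sqrt (complex.Re z ^+ 2 + complex.Im z ^+ 2).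
Proof. by case: z. Qed.

Lemma normcD_le (z w : R[i]) : normc (z + w) <= normc z + normc w.
Proof. exact: le_normcD. Qed.

Lemma normc_ge0 (z : R[i]) : 0 <= normc z.
Proof. by rewrite normcE2 sqrtr_ge0. Qed.

Lemma cmeasurable_normc f : cmeasurable f ->
  measurable_fun setT (fun x => normc (f x)).
Proof.
move=> [mr mi].
under eq_fun do rewrite normcE2 -powR12_sqrt ?addr_ge0 ?sqr_ge0//.
apply: (measurableT_comp (measurable_powR _)) => //.
by apply: measurable_funD; exact: measurable_funX.
Qed.

Lemma cmeasurable0 : cmeasurable (0 : S -> R[i]).
Proof. by split; exact: measurable_cst. Qed.

Lemma cmeasurable_lin (a : R[i]) f g :
  cmeasurable f -> cmeasurable g -> cmeasurable (a *: f + g).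
Proof.
move=> [fr fi] [gr gi]; split.
  rewrite (_ : (fun x => _) = fun x => complex.Re a * complex.Re (f x) -
     complex.Im a * complex.Im (f x) + complex.Re (g x)).
    apply: measurable_funD => //; apply: measurable_funB;
    exact: measurable_funM.
  apply/funext => x; rewrite -[(_ + _) x]/(a * f x + g x).
by case: a (f x) (g x) => [? ?] [? ?] [? ?].
rewrite (_ : (fun x => _) = fun x => complex.Re a * complex.Im (f x) +
   complex.Im a * complex.Re (f x) + complex.Im (g x)).
  apply: measurable_funD => //; apply: measurable_funD;
  exact: measurable_funM.
apply/funext => x; rewrite -[(_ + _) x]/(a * f x + g x).
by case: a (f x) (g x) => [? ?] [? ?] [? ?].
Qed.

Variable mu : {measure set S -> \bar R}.

(* |f| is taken as the real-valued modulus [normc], so that the library Lp-norm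
   of real functions applies. *)
Definition eL2norm f : \bar R := Lnorm mu 2%:E (fun x => (normc (f x))%:E).

Lemma Lnorm2E (h : S -> R) : (forall x, 0 <= h x) ->
  Lnorm mu 2%:E (fun x => (h x)%:E) =
  ((\int[mu]_x ((h x) ^+ 2)%:E) `^ 2^-1)%E.
Proof.
move=> h0; rewrite unlock; congr poweR; apply: eq_integral => x _ /=.
by rewrite ger0_norm// powR_mulrn.
Qed.

Lemma eL2normE f :
  eL2norm f = ((\int[mu]_x ((normc (f x)) ^+ 2)%:E) `^ 2^-1)%E.
Proof. by apply: Lnorm2E => x; exact: normc_ge0. Qed.

Lemma eL2norm_ge0 f : (0 <= eL2norm f)%E.
Proof. exact: Lnorm_ge0. Qed.

Lemma eL2norm0 : eL2norm 0 = 0%E.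
Proof.
have p0 : (2%:E : \bar R) != 0%E by rewrite eqe pnatr_eq0.
rewrite /eL2norm -(Lnorm0 mu p0).
by apply: eq_Lnorm => x /=; rewrite /normc/= expr0n/= addr0 sqrtr0.
Qed.

Lemma eL2normZ a f : cmeasurable f ->
  eL2norm (a *: f) = ((normc a)%:E * eL2norm f)%E.
Proof.
move=> mf; rewrite !eL2normE.
under eq_integral do rewrite fctE normcM exprMn EFinM.
rewrite ge0_integralZl//=; last first.
- by rewrite lee_fin sqr_ge0.
- by move=> x _; rewrite lee_fin sqr_ge0.
- by apply/measurable_EFinP; apply: measurable_funX; exact: cmeasurable_normc.
rewrite poweRM ?lee_fin ?sqr_ge0//; last first.
  by apply: integral_ge0 => x _; rewrite lee_fin sqr_ge0.
by rewrite poweR_EFin powR12_sqrt ?sqr_ge0// sqrtr_sqr ger0_norm ?normc_ge0.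
Qed.

Lemma eL2normD f g : cmeasurable f -> cmeasurable g ->
  (eL2norm (f + g)%R <= eL2norm f + eL2norm g)%E.
Proof.
move=> mf mg.
have mF := cmeasurable_normc mf; have mG := cmeasurable_normc mg.
have mFG : measurable_fun setT (fun x => normc (f x + g x)).
  apply: (@cmeasurable_normc (f + g)); have -> : f + g = 1 *: f + g by rewrite scale1r.
  exact: cmeasurable_lin.
have : (eL2norm (f + g)%R <=
    Lnorm mu 2%:E (fun x => (normc (f x) + normc (g x))%:E))%E.
  rewrite eL2normE Lnorm2E => [|x]; last by rewrite addr_ge0 ?normc_ge0.
  apply: gt0_ler_poweR => //.
  - by rewrite in_itv/= leey andbT integral_ge0// => x _; rewrite lee_fin sqr_ge0.
  - by rewrite in_itv/= leey andbT integral_ge0// => x _; rewrite lee_fin sqr_ge0.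
  apply: ge0_le_integral => //.
  - by move=> x _; rewrite lee_fin sqr_ge0.
  - by apply/measurable_EFinP; exact: measurable_funX.
  - by apply/measurable_EFinP/measurable_funX/measurable_funD.
  move=> x _; rewrite lee_fin ler_sqr ?nnegrE ?addr_ge0 ?normc_ge0//.
  exact: normcD_le.
move=> /le_trans; apply.
by apply: (minkowski_EFin mu mF mG); rewrite ler1n.
Qed.

Definition L2fun_pred : {pred S -> R[i]} :=
  mem [set f | cmeasurable f /\ (eL2norm f < +oo)%E].

Lemma L2fun_predP f :
  f \in L2fun_pred <-> cmeasurable f /\ (eL2norm f < +oo)%E.
Proof. by rewrite inE. Qed.

Lemma L2fun_submod_closed : submod_closed L2fun_pred.
Proof.
split.
  apply/L2fun_predP; split; first exact: cmeasurable0.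
  by rewrite eL2norm0.
move=> a f g /L2fun_predP[mf lf] /L2fun_predP[mg lg]; apply/L2fun_predP.
split; first exact: cmeasurable_lin.
have maf : cmeasurable (a *: f).
  by rewrite -[X in cmeasurable X]addr0; apply: cmeasurable_lin.
apply: le_lt_trans (eL2normD maf mg) _.
rewrite lte_add_pinfty// eL2normZ// lte_mul_pinfty// ?lee_fin ?normc_ge0//.
Qed.

HB.instance Definition _ := GRing.isSubmodClosed.Build _ _ L2fun_pred
  L2fun_submod_closed.

Record L2fun := MkL2fun { L2fun_val :> S -> R[i]; _ : L2fun_val \in L2fun_pred }.

HB.instance Definition _ := [isSub for L2fun_val].
HB.instance Definition _ := [Choice of L2fun by <:].
HB.instance Definition _ := [SubChoice_isSubLmodule of L2fun by <:].

Lemma L2funP (F : L2fun) : cmeasurable F /\ (eL2norm F < +oo)%E.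
Proof. exact/L2fun_predP/(valP F). Qed.

Definition L2null : {pred L2fun} := mem [set F : L2fun | {ae mu, forall x, F x = 0}].

Lemma L2nullP (F : L2fun) : F \in L2null <-> {ae mu, forall x, F x = 0}.
Proof. by rewrite inE. Qed.

Lemma L2null_submod_closed : submod_closed L2null.
Proof.
split; first by rewrite inE /=; exact: nearW.
move=> a F G; rewrite !inE /= => F0 G0; near=> x.
rewrite /= !fctE /= (near F0 x)// (near G0 x)// addr0.
by rewrite scaler0.
Unshelve. all: by end_near. Qed.

HB.instance Definition _ := GRing.isSubmodClosed.Build _ _ L2null
  L2null_submod_closed.

Definition L2 : Type := Quotient.quot L2null.
HB.instance Definition _ := GRing.Zmodule.on L2.
HB.instance Definition _ := EqQuotient.on L2.

Lemma L2_eqP (F G : L2fun) :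
  reflect {ae mu, forall x, F x = G x} (\pi_L2 F == \pi_L2 G).
Proof.
have FG x : (F - G) x = F x - G x by [].
rewrite -Quotient.idealrBE; apply: (iffP idP) => [/L2nullP|FeG].
  by apply: filterS => x; rewrite FG => /subr0_eq.
by apply/L2nullP; apply: filterS FeG => x; rewrite FG => ->; rewrite subrr.
Qed.

Lemma L2_eq (F G : L2fun) : {ae mu, forall x, F x = G x} -> \pi_L2 F = \pi_L2 G.
Proof. by move=> /L2_eqP/eqP. Qed.

Lemma L2_repr (F : L2fun) : {ae mu, forall x, repr (\pi_L2 F) x = F x}.
Proof. by apply/L2_eqP; rewrite reprK. Qed.

Lemma L2_piD (F G : L2fun) : \pi_L2 (F + G) = \pi_L2 F + \pi_L2 G.
Proof. by rewrite !piE. Qed.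

Definition L2_scale (a : R[i]) (u : L2) : L2 := \pi_L2 (a *: repr u).

Lemma L2_scale_pi a (F : L2fun) : L2_scale a (\pi_L2 F) = \pi_L2 (a *: F).
Proof.
apply: L2_eq; have := L2_repr F; apply: filterS => x Fx.
by rewrite -[LHS]/(a *: repr (\pi_L2 F) x) Fx.
Qed.

Fact L2_scaleA a b u : L2_scale a (L2_scale b u) = L2_scale (a * b) u.
Proof. by elim/quotW: u => F; rewrite (L2_scale_pi b F) !L2_scale_pi scalerA. Qed.

Fact L2_scale1 : left_id 1 L2_scale.
Proof. by elim/quotW => F; rewrite !L2_scale_pi scale1r. Qed.

Fact L2_scaleDr : right_distributive L2_scale +%R.
Proof.
move=> a; elim/quotW => F; elim/quotW => G.
by rewrite -L2_piD !L2_scale_pi scalerDr L2_piD.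
Qed.

Fact L2_scaleDl u : {morph L2_scale^~ u : a b / a + b}.
Proof.
by move=> a b; elim/quotW: u => F; rewrite !L2_scale_pi scalerDl L2_piD.
Qed.

HB.instance Definition _ := GRing.Zmodule_isLmodule.Build R[i] L2
  L2_scaleA L2_scale1 L2_scaleDr L2_scaleDl.

Lemma L2_piZ a (F : L2fun) : \pi_L2 (a *: F) = a *: \pi_L2 F.
Proof. by rewrite -L2_scale_pi. Qed.

Definition L2norm (u : L2) : R := fine (eL2norm (repr u)).

Lemma L2norm_piE (F : L2fun) : (L2norm (\pi_L2 F))%:E = eL2norm F.
Proof.
rewrite /L2norm fineK; last first.
  by rewrite ge0_fin_numE ?eL2norm_ge0//; case: (L2funP (repr (\pi_L2 F))).
rewrite !eL2normE; congr poweR; apply: ae_eq_integral => //.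
- apply/measurable_EFinP/measurable_funX/cmeasurable_normc.
  by case: (L2funP (repr (\pi_L2 F))).
- by apply/measurable_EFinP/measurable_funX/cmeasurable_normc; case: (L2funP F).
- by have := L2_repr F; apply: filterS => x /= -> _.
Qed.

Fact L2norm_ge0 u : 0 <= L2norm u.
Proof. by rewrite fine_ge0// eL2norm_ge0. Qed.

Fact L2normD u v : (L2norm (u + v))%:C <= (L2norm u)%:C + (L2norm v)%:C.
Proof.
elim/quotW: u => F; elim/quotW: v => G; rewrite -rmorphD lecR/= -lee_fin EFinD.
rewrite -L2_piD !L2norm_piE.
by apply: eL2normD; [case: (L2funP F)|case: (L2funP G)].
Qed.

Fact L2normZ a u : (L2norm (a *: u))%:C = `|a| * (L2norm u)%:C.
Proof.
elim/quotW: u => F; rewrite -[`|a|]/((normc a)%:C) -rmorphM/=; congr (_%:C).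
apply: EFin_inj; rewrite EFinM -L2_piZ !L2norm_piE.
by apply: eL2normZ; case: (L2funP F).
Qed.

Fact L2norm_eq0 u : (L2norm u)%:C = 0 -> u = 0.
Proof.
elim/quotW: u => F [] /(congr1 (@EFin R)); rewrite L2norm_piE => F0.
have -> : 0 = \pi_L2 0 :> L2 by rewrite !piE.
apply: L2_eq; have [mF _] := L2funP F.
have m2 : measurable_fun setT (fun x => (normc (F x))%:E).
  by apply/measurable_EFinP; exact: cmeasurable_normc.
have := Lnorm_eq0_eq0 m2 (lte0n 2) F0.
by apply: filterS => x /(_ Logic.I) [] /eq0_normc.
Qed.

HB.instance Definition _ := Lmodule_isNormed.Build R[i] L2
  L2normD L2normZ L2norm_eq0.

Lemma L2_normE (u : L2) : `|u| = (L2norm u)%:C.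
Proof. by []. Qed.

End L2fun.

Section kernel_action.
Context d (S : measurableType d) (R : realType).

Definition cRintegral (m : {measure set S -> \bar R}) (f : S -> R[i]) : R[i] :=
  (\int[m]_x complex.Re (f x)) +i* (\int[m]_x complex.Im (f x)).

Variable mu : probability S R.
Implicit Types k : R.-pker S ~> S.

Definition invariant_kernel k :=
  forall A, measurable A -> (\int[mu]_x k x A = mu A)%E.

Definition kernel_fun k (f : S -> R[i]) : S -> R[i] := fun x => cRintegral (k x) f.

(* The default value 0 is only there to make [kernel_op] total: for an invariant
   kernel it is never used, and the result does not depend on the chosen
   representative, see [kernel_op_pi]. *)
Definition kernel_op k (u : L2 mu) : L2 mu :=
  \pi_(L2 mu) (odflt 0 (insub (kernel_fun k (repr u)))).

Lemma invariant_integral k (f : S -> \bar R) : invariant_kernel k ->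
  measurable_fun setT f -> (forall x, 0 <= f x)%E ->
  (\int[mu]_x \int[k x]_y f y = \int[mu]_x f x)%E.
Proof.
move=> kmu mf f0.
pose l : R.-pker S ~> S :=
  kprobability (@measurable_cst _ _ S (pprobability S R) setT mu).
pose k2 : R.-spker (S * S)%type ~> S := kernel.kernel_snd k.
have [x0 _] : [set: S] !=set0.
  apply/set0P/eqP => S0; have := @probability_setT _ _ _ mu.
  by rewrite S0 measure0 => /esym/eqP; rewrite onee_eq0.
have := @integral_kcomp _ _ _ S S S R l k2 x0 f f0 mf; rewrite /= => <-.
apply: eq_measure_integral => A mA _; exact: kmu.
Qed.

Lemma sqr_Rintegral_le (m : {measure set S -> \bar R}) (g : S -> R) :
  m setT = 1%E -> measurable_fun setT g ->
  (((\int[m]_x g x) ^+ 2)%:E <= \int[m]_x ((g x) ^+ 2)%:E)%E.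
Proof.
move=> m1 mg.
have mEg : measurable_fun setT (EFin \o g) by exact/measurable_EFinP.
have i0 : (0 <= \int[m]_x ((g x) ^+ 2)%:E)%E.
  by apply: integral_ge0 => x _; rewrite lee_fin sqr_ge0.
have fin_abs (z : \bar R) : (`|fine z|%:E <= `|z|)%E.
  by case: z => [r||] /=; rewrite ?normr0 ?leey ?lexx.
have le1 : (`|\int[m]_x g x|%:E <= Lnorm m 1 (EFin \o g))%E.
  apply: le_trans (fin_abs _) _; rewrite Lnorm1; exact: le_abse_integral.
have le2 : (Lnorm m 1 (EFin \o g) <= Lnorm m 2%:E (EFin \o g))%E.
  have := @hoelder _ _ _ m g (cst 1) 2 2 mg (measurable_cst _).
  rewrite Lnorm_cst1 m1 poweR1r mule1.
  have -> : g \* cst 1 = g by apply/funext => x /=; rewrite mulr1.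
  by apply; rewrite ?ltr0n// [RHS]splitr div1r.
have lhs : ((`|\int[m]_x g x| ^+ 2)%:E <= (Lnorm m 2%:E (EFin \o g)) `^ 2)%E.
  have /= -> : ((`|\int[m]_x g x| ^+ 2)%:E = `|\int[m]_x g x|%:E `^ 2)%E.
    by rewrite poweR_EFin powR_mulrn.
  rewrite -poweR_EFin; apply: gt0_ler_poweR => //; last exact: le_trans le1 le2.
  - by rewrite in_itv/= leey lee_fin normr_ge0.
  - by rewrite in_itv/= leey Lnorm_ge0.
rewrite real_normK ?num_real// in lhs; apply: le_trans lhs _.
rewrite powR_Lnorm// le_eqVlt; apply/orP; left; apply/eqP.
by apply: eq_integral => x _; rewrite /= powR_mulrn// real_normK ?num_real.
Qed.


Lemma measurable_fun_kernel_integral k (g : S -> R) : measurable_fun setT g ->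
  measurable_fun setT (fun x => \int[k x]_y g y).
Proof.
move=> mg; have mEg : measurable_fun setT (EFin \o g) by exact/measurable_EFinP.
have mpos (h : S -> \bar R) : (forall x, 0 <= h x)%E -> measurable_fun setT h ->
    measurable_fun setT (fun x => \int[k x]_y h y)%E.
  move=> h0 mh.
  apply: (measurable_fun_integral_finite_kernel (fun z : S * S => h z.2) k) => //.
  exact: (measurableT_comp mh).
apply: (measurableT_comp (fine_measurable (measurableT : measurable [set: \bar R]))) => //.
under eq_fun do rewrite integralE.
by apply: emeasurable_funB; apply: mpos => //; [exact: measurable_funepos|
  exact: measurable_funeneg].
Qed.

Lemma kernel_fun_L2 k (F : L2fun mu) : invariant_kernel k ->
  kernel_fun k F \in L2fun_pred mu.
Proof.
move=> kmu; have [[mr mi] lF] := L2funP F.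
have mF2 : measurable_fun setT (fun x => ((normc (F x)) ^+ 2)%:E).
  by apply/measurable_EFinP/measurable_funX/cmeasurable_normc.
have nF0 x : (0 <= ((normc (F x)) ^+ 2)%:E)%E by rewrite lee_fin sqr_ge0.
have mk : cmeasurable (kernel_fun k F).
  by split; exact: measurable_fun_kernel_integral.
apply/L2fun_predP; split => //.
have normc2 z : normc z ^+ 2 = complex.Re z ^+ 2 + complex.Im z ^+ 2 :> R.
  by rewrite normcE2 sqr_sqrtr// addr_ge0 ?sqr_ge0.
apply: le_lt_trans lF; rewrite !eL2normE; apply: gt0_ler_poweR => //.
- by rewrite in_itv/= leey integral_ge0// => x _; rewrite lee_fin sqr_ge0.
- by rewrite in_itv/= leey integral_ge0// => x _; rewrite lee_fin sqr_ge0.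
rewrite -(invariant_integral kmu mF2 nF0).
apply: ge0_le_integral => //.
- by move=> x _; rewrite lee_fin sqr_ge0.
- by apply/measurable_EFinP/measurable_funX/cmeasurable_normc.
- by apply: (measurable_fun_integral_finite_kernel
    (fun z : S * S => ((normc (F z.2)) ^+ 2)%:E) k) => //;
  exact: (measurableT_comp mF2).
move=> x _; rewrite normc2 EFinD.
under eq_integral do rewrite normc2 EFinD.
rewrite ge0_integralD//; last first.
- by apply/measurable_EFinP/measurable_funX.
- by move=> y _; rewrite lee_fin sqr_ge0.
- by apply/measurable_EFinP/measurable_funX.
- by move=> y _; rewrite lee_fin sqr_ge0.
by apply: leeD; apply: sqr_Rintegral_le => //; exact: prob_kernel.
Qed.

Lemma invariant_ae k (P : set S) : invariant_kernel k ->
  {ae mu, forall x, P x} -> {ae mu, forall x, {ae k x, forall y, P y}}.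
Proof.
move=> kmu [N [mN N0 PN]].
have : (\int[mu]_x `|k x N| = 0)%E.
  by rewrite -[RHS]N0 -[RHS]kmu//; apply: eq_integral => x _; rewrite gee0_abs.
have mkN : measurable_fun setT (fun x => k x N) by exact: measurable_kernel.
move/(ae_eq_integral_abs mu measurableT mkN).
apply: filterS => x /(_ Logic.I) kN0; exists N; split => //.
Qed.

Lemma kernel_fun_ae k (F G : L2fun mu) : invariant_kernel k ->
  {ae mu, forall x, F x = G x} ->
  {ae mu, forall x, kernel_fun k F x = kernel_fun k G x}.
Proof.
move=> kmu /(invariant_ae kmu); apply: filterS => x FG.
have [[? ?] _] := L2funP F; have [[? ?] _] := L2funP G.
rewrite /kernel_fun /cRintegral /Rintegral.
by congr (fine _ +i* fine _); apply: ae_eq_integral => //;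
  (try exact/measurable_EFinP); apply: filterS FG => y /= -> _.
Qed.

Lemma kernel_op_pi k (F : L2fun mu) (kmu : invariant_kernel k) :
  kernel_op k (\pi_(L2 mu) F) = \pi_(L2 mu) (MkL2fun (kernel_fun_L2 F kmu)).
Proof.
rewrite /kernel_op insubT /=; first exact: kernel_fun_L2.
move=> p; apply: L2_eq; apply: kernel_fun_ae => //; exact: L2_repr.
Qed.

End kernel_action.

Section generator.
Context d (S : measurableType d) (R : realType).
Variable mu : probability S R.

Definition L2_0 : set (L2 mu) := [set u : L2 mu | cRintegral mu (repr u) = 0].

(* In continuous time, nothing below depends on [P t] for t < 0. *)
Variant markov_dynamics :=
  | Continuous of (R -> R.-pker S ~> S)
  | Discrete of (R.-pker S ~> S).

(* The semigroup identities are those of the operators on L^2(mu): they hold for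
   the transition function of a Markov process, but constrain the kernels only
   up to mu-negligible sets. *)
Definition strongly_continuous_semigroup (P : R -> R.-pker S ~> S) : Prop :=
  [/\ forall u : L2 mu, kernel_op (P 0) u = u,
      forall s t, 0 <= s -> 0 <= t -> forall u : L2 mu,
        kernel_op (P (s + t)) u = kernel_op (P s) (kernel_op (P t) u) &
      forall u : L2 mu, kernel_op (P t) u @[t --> 0^'+] --> u].

Definition stationary_dynamics (X : markov_dynamics) : Prop :=
  match X with
  | Continuous P => (forall t, 0 <= t -> invariant_kernel mu (P t)) /\
                    strongly_continuous_semigroup P
  | Discrete P => invariant_kernel mu P
  end.

Definition stable_under (X : markov_dynamics) (K : set (L2 mu)) : Prop :=
  match X with
  | Continuous P => forall t, 0 <= t -> kernel_op (P t) @` K `<=` K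
  | Discrete P => kernel_op P @` K `<=` K
  end.

Definition diff_quotient (P : R -> R.-pker S ~> S) (u : L2 mu) (t : R) : L2 mu :=
  (t^-1)%:C *: (kernel_op (P t) u - u).

Definition generator_dom (X : markov_dynamics) : set (L2 mu) :=
  match X with
  | Continuous P => [set u | cvg (diff_quotient P u t @[t --> 0^'+])]
  | Discrete _ => setT
  end.

Definition generator (X : markov_dynamics) (u : L2 mu) : L2 mu :=
  match X with
  | Continuous P => lim (diff_quotient P u t @[t --> 0^'+])
  | Discrete P => kernel_op P u - u
  end.

Definition restricted_dom (X : markov_dynamics) (K : set (L2 mu)) : set (L2 mu) :=
  generator_dom X `&` K.

(* Partial operators are given by a domain and a total function whose values
   outside the domain are irrelevant. *)
Implicit Types (D K : set (L2 mu)) (A T : L2 mu -> L2 mu).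

(* [ereal_inf set0 = +oo], and [+oo^-1 = 0] in [\bar R]. *)
Definition minimum_modulus D A : \bar R :=
  ereal_inf [set (L2norm (A u) / L2norm u)%:E | u in D `\ 0].

Definition inverse_on D K A T : Prop :=
  [/\ set_fun K D T, {in D, cancel A T} & {in K, cancel T A}].

Definition bounded_on K T : Prop :=
  exists M : R, forall u, K u -> L2norm (T u) <= M * L2norm u.

(* The supremum runs over a set containing [u = 0] whenever K is a subspace, so
   it is 0 (and not -oo) for K = {0}. *)
Definition opnorm_on K T : \bar R :=
  ereal_sup [set (L2norm (T u))%:E | u in K `&` [set u | L2norm u <= 1]].

End generator.

Arguments L2_0 {d S R} mu.

(* Main.v *)
Require Import Defs.
From HB Require Import structures.
From mathcomp Require Import all_boot all_order all_algebra.
From mathcomp Require Import ring_quotient generic_quotient ring lra.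
From mathcomp Require Import all_classical all_reals all_analysis.
From mathcomp Require Import measurable_realfun hoelder kernel complex.

Import Order.TTheory GRing.Theory Num.Theory.
Import numFieldNormedType.Exports.

Local Open Scope classical_set_scope.
Local Open Scope ring_scope.

(** Why the theorem holds.  A positive minimum modulus c gives
    c |f| <= |L f| on the domain of L in K, hence injectivity and the bound on
    the inverse; the whole difficulty is that L maps its domain onto K.

    The argument is Hilbertian and avoids resolvents.  Fix x in K.  The vectors
    x + L f, with f in the domain, contain one of minimal norm, say g: by the
    parallelogram identity a minimizing sequence x + L f_n is Cauchy, by the
    lower bound f_n is then Cauchy too, and L is closed.  Now every increment
    P_t g - g lies in the range of L, so that g + (P_t g - g) / 2, the midpoint
    of g and P_t g, is still of the form x + L f and has norm at least |g|.
    Since |P_t g| <= |g|, the parallelogram identity forces P_t g = g.  As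
    this holds for all t, L g = 0, and the lower bound gives g = 0, that is,
    x belongs to the range of L.  The minimization is
    [closed_relation_onto], the rigidity of contractions is [contraction_fix].

    In discrete time L = P - I is bounded and everything above is immediate
    ([contraction_onto]).  In continuous time ([generator_onto]) two facts on
    semigroups are needed: L is closed, and increments lie in its range.  Both
    usually come from the identity P_t f - f = \int_0^t P_s L f ds.  Vector
    integrals are replaced here by the inequality [integrated], which says that
    P_t f - f differs from t w by at most t times the oscillation of P_s w for
    s in [0, t]; it characterizes w = L f ([has_generator_integrated],
    [integrated_has_generator]) and clearly survives limits in f and w
    ([integrated_closed]).  The preimage of P_a g - g, classically
    \int_0^a P_s g ds, is the limit of dyadic Riemann sums ([riemann_cvg],
    [riemann_integrated]).

    What remains is to see that L^2(mu) is a Hilbert space on which invariant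
    Markov kernels act as linear contractions: completeness is Riesz-Fischer
    ([riesz_fischer]), the parallelogram identity is pointwise
    ([L2R_parallelogram]), linearity and contractivity are [markov_op_linear]
    and [markov_op_le].  Only real scalars matter, so L^2(mu) is handled as a
    normed space over R, where norms can be compared by ordinary
    inequalities. *)

(** * Closed relations bounded below, by norm minimization *)

Definition parallelogram (R : realType) (V : normedModType R) : Prop :=
  forall x y : V, `|x + y| ^+ 2 + `|x - y| ^+ 2 = 2 * (`|x| ^+ 2 + `|y| ^+ 2).

Section hilbert.
Context (R : realType) (V : completeNormedModType R).
Hypothesis para : parallelogram R V.
Implicit Types (x y f g w : V).

Lemma cauchy_seq_cvg (u : nat -> V) :
  (forall e : R, 0 < e ->
     exists N, forall m, (N <= m)%N -> `|u m - u N| <= e) ->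
  cvgn u.
Proof.
move=> uC; apply/cauchy_cvgP/cauchyP => e e0.
have [N uN] := uC _ (divr_gt0 e0 (ltr0n R 2)).
exists (u N); exists N => // m /= Nm.
rewrite -ball_normE /= distrC (le_lt_trans (uN _ Nm))//.
by rewrite ltr_pdivrMr// ltr_pMr// ltr1n.
Qed.

Lemma cauchy_rate_cvg (u : nat -> V) (e : nat -> R) : e n @[n --> \oo] --> 0 ->
  (forall n m, (n <= m)%N -> `|u m - u n| <= e n) -> cvgn u.
Proof.
move=> e0 ue; apply: cauchy_seq_cvg => r r0.
have [N _ /(_ N (leqnn N)) eN] := (cvgrPdist_le _ _).1 e0 r r0.
exists N => m Nm; apply: le_trans (ue _ _ Nm) _.
by apply: le_trans eN; rewrite sub0r normrN ler_norm.
Qed.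

Lemma midpoint_diag x : 2^-1 *: (x + x) = x.
Proof. by rewrite -[X in X + X]scale1r -scalerDl scalerA mulVf ?scale1r. Qed.

Lemma midpoint_norm x y : `|x - y| ^+ 2 =
  2 * (`|x| ^+ 2 + `|y| ^+ 2) - 4 * `|2^-1 *: (x + y)| ^+ 2.
Proof.
rewrite -para normrZ exprMn ger0_norm ?invr_ge0// exprVn.
by rewrite mulrA (_ : 4 / 2 ^+ 2 = 1) ?mul1r; [ring|field].
Qed.

(** If [T g] were different from [g], the midpoint of [g] and [T g] would be
    strictly shorter than [g], by uniform convexity. *)
Lemma contraction_fix (T : V -> V) g :
  `|T g| <= `|g| -> `|g| <= `|g + 2^-1 *: (T g - g)| -> T g = g.
Proof.
move=> Tg gm; apply/eqP; rewrite -subr_eq0 -normr_eq0 -sqrf_eq0.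
rewrite eq_le sqr_ge0 andbT midpoint_norm.
have -> : 2^-1 *: (T g + g) = g + 2^-1 *: (T g - g).
  rewrite -[X in _ = X + _]midpoint_diag -scalerDr; congr (_ *: _).
  by rewrite addrCA -addrA subrr addr0 addrC.
have := lerXn2r 2 (normr_ge0 _) (normr_ge0 _) Tg.
by have := lerXn2r 2 (normr_ge0 _) (normr_ge0 _) gm; lra.
Qed.

(** [G] is the graph of an unbounded operator.  The last hypothesis, on vectors
    that are shortest in their class modulo the range, is the only place where
    the semigroup enters. A shortest vector of [x] modulo the range exists
    because the range is closed, and the hypothesis together with the lower
    bound makes it vanish. *)
Lemma closed_relation_onto (K : set V) (G : V -> V -> Prop) (c : R) :
  0 < c ->
  (forall f w, G f w -> K w) ->
  (forall (a : R) f w f' w', G f w -> G f' w' ->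
     G (a *: f + f') (a *: w + w')) ->
  G 0 0 ->
  (forall (u v : nat -> V) f w, (forall n, G (u n) (v n)) ->
    u n @[n --> \oo] --> f -> v n @[n --> \oo] --> w -> G f w) ->
  (forall x y, K x -> K y -> K (x + y)) ->
  (forall f w, G f w -> c * `|f| <= `|w|) ->
  (forall g, K g -> (forall f w, G f w -> `|g| <= `|g + w|) -> G g 0) ->
  forall x, K x -> exists f, G f x.
Proof.
move=> c0 GK Glin G0 Gcl KD Gc Gmin x Kx.
have Gadd f w f' w' : G f w -> G f' w' -> G (f + f') (w + w').
  by move=> h /(Glin 1 _ _ _ _ h); rewrite !scale1r.
pose E := [set `|x + w| ^+ 2 | w in [set w | exists f, G f w]].
have infE : has_inf E.
  split; first by exists (`|x + 0| ^+ 2), 0 => //; exists 0.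
  by exists 0 => _ [w _ <-]; exact: sqr_ge0.
have lbE f w : G f w -> inf E <= `|x + w| ^+ 2.
  by move=> Gfw; apply: ge_inf; [case: infE|exists w => //; exists f].
have /choice[fw fwP] n : exists p : V * V,
    G p.1 p.2 /\ `|x + p.2| ^+ 2 < inf E + n.+1%:R^-1.
  have [|_ [w [f Gfw] <-] h] := inf_adherent (eps := n.+1%:R^-1) _ infE.
    by rewrite invr_gt0.
  by exists (f, w).
have Gn n : G (fw n).1 (fw n).2 by case: (fwP n).
(* parallelogram identity: two almost minimal vectors are close, because their
   midpoint cannot be much shorter than the infimum *)
have wC n m : (n <= m)%N -> `|(fw m).2 - (fw n).2| <= Num.sqrt (4 * n.+1%:R^-1).
  move=> nm; rewrite -(@ger0_norm _ `|_|)// -sqrtr_sqr ler_sqrt; last first.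
    by rewrite mulr_ge0 ?invr_ge0.
  have -> : (fw m).2 - (fw n).2 = (x + (fw m).2) - (x + (fw n).2).
    by rewrite opprD addrACA subrr add0r.
  rewrite midpoint_norm.
  have -> : 2^-1 *: (x + (fw m).2 + (x + (fw n).2)) =
      x + 2^-1 *: ((fw m).2 + (fw n).2).
    by rewrite addrACA scalerDr midpoint_diag.
  have Gmid : G (2^-1 *: ((fw m).1 + (fw n).1))
                (2^-1 *: ((fw m).2 + (fw n).2)).
    have := Glin 2^-1 _ _ _ _ (Gadd _ _ _ _ (Gn m) (Gn n)) G0.
    by rewrite !addr0.
  have := lbE _ _ Gmid; have [_] := fwP n; have [_] := fwP m.
  have : m.+1%:R^-1 <= n.+1%:R^-1 :> R by rewrite lef_pV2 ?posrE ?ler_nat.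
  have arith (i a b p en em : R) : em <= en -> a < i + em -> b < i + en ->
      i <= p -> 2 * (a + b) - 4 * p <= 4 * en by lra.
  exact: arith.
have e0 : Num.sqrt (4 * n.+1%:R^-1 : R) @[n --> \oo] --> 0.
  rewrite -[X in _ --> X]sqrtr0; apply: continuous_cvg.
    exact: sqrt_continuous.
  rewrite -[X in _ --> X](mulr0 4); apply: cvgMr; exact: cvg_harmonic.
have /cvg_ex[w wl] : cvgn (fun n => (fw n).2) by exact: cauchy_rate_cvg wC.
have /cvg_ex[f fl] : cvgn (fun n => (fw n).1).
  apply: (cauchy_rate_cvg _ (fun n => c^-1 * Num.sqrt (4 * n.+1%:R^-1 : R))).
    by rewrite -[X in _ --> X](mulr0 c^-1); apply: cvgMr.
  move=> n m nm; rewrite -(ler_pM2l c0) mulrA mulfV ?gt_eqF// mul1r.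
  apply: le_trans (wC _ _ nm); apply: Gc.
  have := Glin (-1) _ _ _ _ (Gn n) (Gn m).
  by rewrite !scaleN1r ![- _ + _]addrC.
have Gfw : G f w by exact: Gcl Gn fl wl.
have xw2 : `|x + w| ^+ 2 <= inf E.
  have lim : (inf E + n.+1%:R^-1) @[n --> \oo] --> inf E + 0.
    by apply: cvgD; [exact: cvg_cst|exact: cvg_harmonic].
  have lim2 : `|x + (fw n).2| ^+ 2 @[n --> \oo] --> `|x + w| ^+ 2.
    rewrite expr2; under eq_fun do rewrite expr2.
    have h : `|x + (fw n).2| @[n --> \oo] --> `|x + w|.
      by apply: cvg_norm; apply: cvgD => //; exact: cvg_cst.
    exact: cvgM.
  rewrite -(addr0 (inf E)).
  apply: ler_cvg_to lim2 lim _; near=> n; exact: ltW (fwP n).2.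
have : G (x + w) 0.
  apply: Gmin => [|f' w' Gf'w']; first by apply: KD => //; exact: GK Gfw.
  rewrite -ler_sqr ?nnegrE// (le_trans xw2)// -addrA; apply: lbE.
  exact: Gadd Gfw Gf'w'.
move/Gc; rewrite normr0 pmulr_rle0// normr_le0 => /eqP xw0.
exists (- f); have -> : x = - w by apply/eqP; rewrite -addr_eq0 xw0.
by have := Glin (-1) _ _ _ _ Gfw G0; rewrite !scaleN1r !addr0.
Unshelve. all: by end_near. Qed.

End hilbert.

(** * Generators of contraction semigroups *)

Lemma subrACA {V : zmodType} (x y z w : V) :
  (x - y) - (z - w) = (x - z) - (y - w).
Proof. by rewrite opprD addrACA -opprD. Qed.

Section contraction_semigroup.
Context (R : realType) (V : completeNormedModType R).
Variable T : R -> {linear V -> V}.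
Hypothesis T_le : forall t x, `|T t x| <= `|x|.
Hypothesis T0 : forall x, T 0 x = x.
Hypothesis TD : forall s t : R, 0 <= s -> 0 <= t ->
  forall x, T (s + t) x = T s (T t x).
Hypothesis T_cont : forall x, T t x @[t --> 0^'+] --> x.
Implicit Types (f g w x y : V) (h s t e : R) (n m k : nat).

Definition has_generator f w := t^-1 *: (T t f - f) @[t --> 0^'+] --> w.

Lemma has_generator_linear a f w f' w' :
  has_generator f w -> has_generator f' w' ->
  has_generator (a *: f + f') (a *: w + w').
Proof.
move=> fw fw'; rewrite /has_generator.
under eq_fun do rewrite linearP opprD addrACA scalerDr -scalerBr scalerA mulrC
  -scalerA.
by apply: cvgD => //; apply: cvgZl_tmp.
Qed.

Definition osc_le w t e := forall s : R, 0 <= s <= t -> `|T s w - w| <= e.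

Lemma osc_small w (e : R) : 0 < e -> exists2 t : R, 0 < t & osc_le w t e.
Proof.
move=> e0; have /cvgrPdist_le/(_ _ e0) := T_cont w.
case=> d /= d0 H; exists (d / 2); first by rewrite divr_gt0.
move=> s /andP[]; rewrite le_eqVlt => /predU1P[<- _|s0 sd].
  by rewrite T0 subrr normr0 ltW.
rewrite distrC; apply: H => //=; rewrite sub0r normrN gtr0_norm//.
by apply: le_lt_trans sd _; rewrite ltr_pdivrMr// ltr_pMr// ltr1n.
Qed.

Lemma T_sub_le s x : `|T s x - x| <= 2 * `|x|.
Proof. by rewrite (le_trans (ler_normB _ _))// mulrDl mul1r lerD. Qed.

Definition orbit_sum h n g := \sum_(k < n) T (k%:R * h) g.

Lemma orbit_sumB h n x y :
  orbit_sum h n (x - y) = orbit_sum h n x - orbit_sum h n y.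
Proof. by rewrite -sumrB; apply: eq_bigr => k _; rewrite linearB. Qed.

Lemma orbit_sumZ h n a x : orbit_sum h n (a *: x) = a *: orbit_sum h n x.
Proof. by rewrite scaler_sumr; apply: eq_bigr => k _; rewrite linearZ. Qed.

Lemma T_natD (h : R) n k g : 0 <= h ->
  T ((n + k)%:R * h) g = T (n%:R * h) (T (k%:R * h) g).
Proof. by move=> h0; rewrite natrD mulrDl TD ?mulr_ge0. Qed.

Lemma orbit_sumD (h : R) n k g : 0 <= h ->
  orbit_sum h (n + k) g = orbit_sum h n g + T (n%:R * h) (orbit_sum h k g).
Proof.
move=> h0; rewrite /orbit_sum big_split_ord linear_sum; congr (_ + _).
by apply: eq_bigr => i _; rewrite -T_natD.
Qed.

Lemma orbit_sumM (h : R) n k g : 0 <= h ->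
  orbit_sum h (n * k) g = orbit_sum (k%:R * h) n (orbit_sum h k g).
Proof.
move=> h0; elim: n => [|n IHn]; first by rewrite /orbit_sum !big_ord0.
rewrite mulSnr orbit_sumD// IHn [in RHS]/orbit_sum big_ord_recr /=.
by rewrite natrM mulrA.
Qed.

Lemma orbit_sum_telescope (h : R) n g : 0 <= h ->
  T (n%:R * h) g - g = orbit_sum h n (T h g - g).
Proof.
move=> h0; elim: n => [|n IHn].
  by rewrite mul0r T0 subrr /orbit_sum big_ord0.
rewrite /orbit_sum big_ord_recr /= -/(orbit_sum h n _) -IHn linearB.
by rewrite -natr1 mulrDl mul1r TD ?mulr_ge0// addrC addrA subrK.
Qed.

Lemma orbit_sum_le h n g : `|orbit_sum h n g| <= n%:R * `|g|.
Proof.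
apply: le_trans (ler_norm_sum _ _ _) _.
rewrite mulr_natl -[X in _ *+ X]card_ord -sumr_const.
exact: ler_sum.
Qed.

Lemma orbit_sum_osc (h : R) n w (e : R) : 0 <= h -> osc_le w (n%:R * h) e ->
  `|orbit_sum h n w - n%:R *: w| <= n%:R * e.
Proof.
move=> h0 we.
rewrite scaler_nat -[X in _ *+ X]card_ord -sumr_const -sumrB.
apply: le_trans (ler_norm_sum _ _ _) _.
rewrite mulr_natl -[X in _ *+ X]card_ord -sumr_const.
apply: ler_sum => k _; apply: we; rewrite mulr_ge0//= ler_wpM2r// ler_nat.
exact/ltnW.
Qed.

(** What remains of T_t f - f = \int_0^t T_s w ds when the integral is estimated
    by its integrand: a form of [has_generator] that is stable under limits. *)
Definition integrated f w :=
  forall t e : R, 0 <= t -> osc_le w t e -> `|T t f - f - t *: w| <= t * e.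

(** Cut [0, t] into n steps of length h: T_t f - f is the sum over k of
    T_{kh} (T_h f - f), where T_h f - f is h w up to o(h) and T_{kh} w is w up
    to the oscillation.  The n errors o(h) add up to o(1) since T contracts. *)
Lemma has_generator_integrated f w : has_generator f w -> integrated f w.
Proof.
move=> fw t e; rewrite le_eqVlt => /predU1P[<- _|t0 we].
  by rewrite T0 subrr scale0r subrr normr0 mul0r.
apply/ler_addgt0Pr => r r0.
have rt0 : 0 < r / t by rewrite divr_gt0.
have ht : (t / n.+1%:R) @[n --> \oo] --> 0^'+.
  have ht0 : (t / n.+1%:R) @[n --> \oo] --> (0 : R).
    by rewrite -[X in _ --> X](mulr0 t); apply: cvgMr; exact: cvg_harmonic.
  move=> A hA; have : \forall n \near \oo, 0 < t / n.+1%:R -> A (t / n.+1%:R).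
    exact: ht0 hA.
  by apply: filterS => n; apply; rewrite divr_gt0.
have [n _ /(_ _ (leqnn n))] := ht _ ((cvgrPdist_le _ _).1 fw _ rt0).
move=> /=; set h := t / n.+1%:R => hr.
have h0 : 0 < h by rewrite divr_gt0.
have tE : t = n.+1%:R * h by rewrite mulrC divfK.
clearbody h.
have -> : T t f - f - t *: w =
    orbit_sum h n.+1 (T h f - f - h *: w) +
    h *: (orbit_sum h n.+1 w - n.+1%:R *: w).
  have -> : orbit_sum h n.+1 (T h f - f - h *: w) =
      orbit_sum h n.+1 (T h f - f) - h *: orbit_sum h n.+1 w.
    rewrite scaler_sumr -sumrB; apply: eq_bigr => i _.
    by rewrite linearB linearZ.
  rewrite -orbit_sum_telescope ?ltW// -tE scalerBr scalerA mulrC -tE.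
  by rewrite addrA subrK.
rewrite addrC.
apply: le_trans (ler_normD _ _) _; apply: lerD.
  rewrite normrZ gtr0_norm// [X in X * e]tE [_ * h]mulrC -mulrA ler_pM2l//.
  by apply: orbit_sum_osc; [exact: ltW|rewrite -tE].
apply: le_trans (orbit_sum_le _ _ _) _.
have -> : T h f - f - h *: w = - h *: (w - h^-1 *: (T h f - f)).
  rewrite scalerBr scalerA mulNr mulfV ?gt_eqF// !scaleNr scale1r opprK.
  by rewrite addrC.
by rewrite normrZ normrN gtr0_norm// mulrA -tE -ler_pdivlMl// [leRHS]mulrC.
Qed.

Lemma integrated_has_generator f w : integrated f w -> has_generator f w.
Proof.
move=> fw; apply/cvgrPdist_le => e e0.
have [t t0 wt] := osc_small w e e0.
near=> s.
have s0 : 0 < s by [].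
have st : s <= t by near: s; exact: nbhs_right_le.
have -> : w - s^-1 *: (T s f - f) = - s^-1 *: (T s f - f - s *: w).
  rewrite [RHS]scalerBr scalerA mulNr mulVf ?gt_eqF// !scaleNr scale1r opprK.
  by rewrite addrC.
rewrite normrZ normrN gtr0_norm ?invr_gt0// ler_pdivrMl//.
apply: fw; first exact: ltW.
by move=> r /andP[r0 rs]; apply: wt; rewrite r0 (le_trans rs).
Unshelve. all: by end_near. Qed.

(** The oscillation of T_s w depends on w in a Lipschitz way, so both sides of
    the estimate pass to the limit. *)
Lemma integrated_closed (u v : nat -> V) f w : u n @[n --> \oo] --> f ->
  v n @[n --> \oo] --> w -> (forall n, integrated (u n) (v n)) ->
  integrated f w.
Proof.
move=> uf vw uv t e t0 we.
apply/ler_addgt0Pr => r r0.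
pose d := r / (2 + t * 3).
(* the errors to be absorbed: 2 d for f, and t d + 2 t d for w *)
have d0 : 0 < d by rewrite divr_gt0// ltr_pwDl// mulr_ge0.
have [n] : exists n, `|f - u n| <= d /\ `|w - v n| <= d.
  have := filterI ((cvgrPdist_le _ _).1 uf _ d0) ((cvgrPdist_le _ _).1 vw _ d0).
  by case=> n _ /(_ _ (leqnn n)) ?; exists n.
move=> [fd wd].
have vn : osc_le (v n) t (e + 2 * d).
  move=> s st.
  have -> : T s (v n) - v n = (T s w - w) - (T s (w - v n) - (w - v n)).
    by rewrite (linearB (T s)) (subrACA _ (T s (v n))) subKr.
  apply: le_trans (ler_normB _ _) _; rewrite lerD ?we//.
  by rewrite (le_trans (T_sub_le _ _))// ler_pM2l.
have -> : T t f - f - t *: w = (T t (u n) - u n - t *: v n) +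
   ((T t (f - u n) - (f - u n)) - t *: (w - v n)).
  rewrite (linearB (T t)) scalerBr.
  by rewrite (subrACA (T t f)) (subrACA (T t f - f)) subrKC.
apply: le_trans (ler_normD _ _) _.
apply: le_trans (lerD (uv n t _ t0 vn) (ler_normB _ _)) _.
rewrite normrZ ger0_norm//.
have h1 := le_trans (T_sub_le t (f - u n)) (ler_wpM2l (ler0n _ 2) fd).
have h2 := ler_wpM2l t0 wd.
have rE : r = d * (2 + t * 3) by rewrite divfK// gt_eqF// ltr_pwDl// mulr_ge0.
rewrite rE; nra.
Qed.

Lemma telescope4 (x y z p q v w : V) : x - y - (v + w) =
  (x - p - (y - z)) + (p - q) + (q - z - v) - w.
Proof.
rewrite subrACA opprD addrA addrA; congr (_ - _ - _).
by rewrite -(addrA (x - y - _)) subrKA subrK.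
Qed.

Lemma T_orbit_sum (h : R) n k g : 0 <= h ->
  T (n%:R * h) (orbit_sum h k g) = orbit_sum h k (T (n%:R * h) g).
Proof.
move=> h0; rewrite linear_sum; apply: eq_bigr => i _.
by rewrite -!T_natD// addnC.
Qed.

(** The discrete counterpart of
    (T_t - I) \int_0^a T_s g ds = \int_0^t T_s (T_a g - g) ds: both are the
    sum over n + k steps minus the sums over n and over k steps. *)
Lemma orbit_sum_sym (h : R) n k g : 0 <= h ->
  T (k%:R * h) (orbit_sum h n g) - orbit_sum h n g =
  orbit_sum h k (T (n%:R * h) g - g).
Proof.
move=> h0; rewrite orbit_sumB -T_orbit_sum//; apply/eqP.
rewrite subr_eq addrAC eq_sym subr_eq eq_sym addrC -orbit_sumD// addnC.
by rewrite orbit_sumD// addrC.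
Qed.

Definition mesh a n : R := a / 2 ^+ n.
(** Riemann sums of \int_0^a T_s g ds; along powers of 2 the partitions are
    nested. *)
Definition riemann a g n := mesh a n *: orbit_sum (mesh a n) (2 ^ n) g.

Lemma mesh_gt0 (a : R) n : 0 < a -> 0 < mesh a n.
Proof. by move=> a0; rewrite divr_gt0// exprn_gt0. Qed.

Lemma mesh_sum a n : (2 ^ n)%:R * mesh a n = a.
Proof. by rewrite natrX mulrC divfK// expf_neq0. Qed.

Lemma mesh_refine a n k : mesh a n = (2 ^ k)%:R * mesh a (n + k).
Proof. by rewrite /mesh exprD natrX; field; rewrite !expf_neq0. Qed.

Lemma mesh_cvg0 a : mesh a n @[n --> \oo] --> 0.
Proof.
rewrite -[X in _ --> X](mulr0 a); apply: cvgMr.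
under eq_fun do rewrite -exprVn -[_ ^+ _]mul1r.
by apply: cvg_geometric; rewrite ger0_norm// invf_lt1// ltr1n.
Qed.

(** Refining a partition replaces, in each cell, T_{kh} g by T_{kh} applied to
    an average of T_s g over small s; as T contracts, the change is controlled
    by the oscillation of T_s g near s = 0 alone, uniformly in the cell. *)
Lemma riemann_cvg (a : R) g : 0 < a -> cvgn (riemann a g).
Proof.
move=> a0; apply: cauchy_seq_cvg => e e0.
have [t t0 gt] := osc_small g _ (divr_gt0 e0 a0).
have [N _ /(_ _ (leqnn N)) /=] := (cvgrPdist_le _ _).1 (mesh_cvg0 a) t t0.
rewrite sub0r normrN gtr0_norm ?mesh_gt0// => Nt.
exists N => m /subnKC <-; set k := (m - N)%N.
set h := mesh a (N + k); have h0 : 0 < h by exact: mesh_gt0.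
have hN : mesh a N = (2 ^ k)%:R * h by exact: mesh_refine.
have -> : riemann a g (N + k) - riemann a g N =
    h *: orbit_sum (mesh a N) (2 ^ N) (orbit_sum h (2 ^ k) g - (2 ^ k)%:R *: g).
  rewrite /riemann expnD orbit_sumM ?ltW// -/h -hN orbit_sumB orbit_sumZ.
  by rewrite scalerBr scalerA [h * _]mulrC -hN.
rewrite normrZ gtr0_norm//.
apply: le_trans (ler_wpM2l (ltW h0) (orbit_sum_le _ _ _)) _.
have osc : osc_le g ((2 ^ k)%:R * h) (e / a).
  by rewrite -hN => s /andP[s0 sN]; apply: gt; rewrite s0 (le_trans sN).
have osck := orbit_sum_osc _ _ _ _ (ltW h0) osc.
apply: le_trans (ler_wpM2l (ltW h0) (ler_wpM2l (ler0n _ _) osck)) _.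
have aE : (2 ^ N)%:R * ((2 ^ k)%:R * h) = a by rewrite -hN mesh_sum.
rewrite (_ : h * _ = (2 ^ N)%:R * ((2 ^ k)%:R * h) * (e / a)); last by ring.
by rewrite aE mulrC divfK// gt_eqF.
Qed.

Lemma riemann_increment (a : R) g n k : 0 < a ->
  T (k%:R * mesh a n) (riemann a g n) - riemann a g n =
  mesh a n *: orbit_sum (mesh a n) k (T a g - g).
Proof.
move=> a0; have TZ t b x : T t (b *: x) = b *: T t x by rewrite linearZ.
rewrite /riemann TZ -scalerBr orbit_sum_sym ?mesh_sum//.
exact/ltW/mesh_gt0.
Qed.

(** When t is a multiple of the mesh this is [riemann_increment] in the limit.
    Otherwise t = j h + s with 0 <= s <= h, and the remainder s contributes
    T_{jh} (T_s f - f), small by strong continuity, and s w. *)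
Lemma riemann_integrated (a : R) g f : 0 < a ->
  riemann a g n @[n --> \oo] --> f ->
  integrated f (T a g - g).
Proof.
set w := T a g - g => a0 gf t e t0 we.
have e0 : 0 <= e by apply: le_trans (we 0 _); rewrite ?normr_ge0// lexx.
apply/ler_addgt0Pr => r r0.
(* 2 d for f - u under T_t, 3 d for the remainder s under T_s, |w| d for s w *)
pose d := r / (5 + `|w|).
have d0 : 0 < d by rewrite divr_gt0// ltr_pwDl.
have [t1 t10 ft1] := osc_small f d d0.
have [n [fd hd ht1]] : exists n, [/\ `|f - riemann a g n| <= d,
    mesh a n <= d & mesh a n <= t1].
  have [n _ /(_ _ (leqnn n)) [] /=] := filterI ((cvgrPdist_le _ _).1 gf _ d0)
    (filterI ((cvgrPdist_le _ _).1 (mesh_cvg0 a) _ d0)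
     ((cvgrPdist_le _ _).1 (mesh_cvg0 a) _ t10)).
  by rewrite !sub0r !normrN !gtr0_norm ?mesh_gt0// => ? []; exists n.
set u := riemann a g n in fd; set h := mesh a n in hd ht1.
have h0 : 0 < h by exact: mesh_gt0.
pose j := Num.truncn (t / h).
have /andP[jt tj] : j%:R <= t / h < j.+1%:R.
  by apply: truncn_itv; rewrite divr_ge0// ltW.
rewrite ler_pdivlMr// in jt.
rewrite ltr_pdivrMr// -natr1 mulrDl mul1r in tj.
pose s := t - j%:R * h.
have s0 : 0 <= s by rewrite subr_ge0.
have sh : s <= h by rewrite lerBlDl ltW.
have tE : t = j%:R * h + s by rewrite subrKC.
clearbody s.
have Tt : T (j%:R * h) (T s u) = T t u.
  by rewrite [in RHS]tE TD// mulr_ge0// ltW.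
have -> : T t f - f - t *: w =
    (T t (f - u) - (f - u)) + T (j%:R * h) (T s u - u) +
    (T (j%:R * h) u - u - (j%:R * h) *: w) - s *: w.
  rewrite (linearB (T t)) (linearB (T (j%:R * h))) Tt.
  rewrite [in t *: w]tE scalerDl.
  exact: telescope4.
have b1 : `|T t (f - u) - (f - u)| <= 2 * d.
  by apply: le_trans (T_sub_le _ _) _; rewrite ler_pM2l.
have b2 : `|T (j%:R * h) (T s u - u)| <= 3 * d.
  apply: le_trans (T_le _ _) _.
  have -> : T s u - u = (T s f - f) - (T s (f - u) - (f - u)).
    by rewrite (linearB (T s)) (subrACA _ (T s u)) subKr.
  apply: le_trans (ler_normB _ _) _; rewrite (_ : 3 = 1 + 2)// mulrDl mul1r.
  apply: lerD; first by apply: ft1; rewrite s0 (le_trans sh).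
  by apply: le_trans (T_sub_le _ _) _; rewrite ler_pM2l.
have b3 : `|T (j%:R * h) u - u - (j%:R * h) *: w| <= t * e.
  rewrite riemann_increment// -/w -/h.
  rewrite (mulrC _ h) -(scalerA h) -scalerBr normrZ gtr0_norm//.
  have : `|orbit_sum h j w - j%:R *: w| <= j%:R * e.
    apply: orbit_sum_osc; first exact: ltW.
    by move=> s' /andP[s'0 s'j]; apply: we; rewrite s'0 (le_trans s'j).
  move/(ler_wpM2l (ltW h0))/le_trans; apply.
  by rewrite mulrA ler_wpM2r// mulrC.
have b4 : `|s *: w| <= d * `|w|.
  by rewrite normrZ ger0_norm// ler_wpM2r// (le_trans sh).
apply: le_trans (ler_normB _ _) _.
apply: le_trans (lerD (ler_normD _ _) b4) _.
apply: le_trans (lerD (lerD (ler_normD _ _) b3) (lexx _)) _.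
have rE : r = d * (5 + `|w|) by rewrite divfK// gt_eqF// ltr_pwDl.
rewrite rE; nra.
Qed.

Section invariant_subspace.
Variable K : set V.
Hypothesis Kcl : closed K.
Hypothesis K0 : K 0.
Hypothesis Klin : forall a x y, K x -> K y -> K (a *: x + y).
Hypothesis KT : forall (t : R) x, 0 <= t -> K x -> K (T t x).

Let KZ a x : K x -> K (a *: x).
Proof. by move=> Kx; rewrite -[_ *: _]addr0; exact: Klin. Qed.

Let KD x y : K x -> K y -> K (x + y).
Proof. by move=> Kx Ky; rewrite -[x]scale1r; exact: Klin. Qed.

Lemma riemann_in (a : R) g n : 0 < a -> K g -> K (riemann a g n).
Proof.
move=> a0 Kg; apply: KZ; rewrite /orbit_sum.
apply: (big_ind K) => // k _; apply: KT => //.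
by rewrite mulr_ge0// ltW// mesh_gt0.
Qed.

Lemma increment_in_range (a : R) g : 0 < a -> K g ->
  exists2 f, K f & has_generator f (T a g - g).
Proof.
move=> a0 Kg; have /cvg_ex[f gf] := riemann_cvg _ g a0.
exists f; last exact/integrated_has_generator/(riemann_integrated _ _ _ a0 gf).
apply: (closed_cvg K Kcl _ _ gf); near=> n; exact: riemann_in.
Unshelve. all: by end_near. Qed.

Lemma generator_in f w : K f -> has_generator f w -> K w.
Proof.
move=> Kf fw; apply: (closed_cvg K Kcl _ _ fw); near=> t; apply: KZ.
by rewrite addrC -scaleN1r; apply: Klin => //; exact: KT.
Unshelve. all: by end_near. Qed.

(** [closed_relation_onto] for the generator: a shortest vector g of its class
    is fixed by every T_t, because increments lie in the range of the generator,
    so the generator vanishes at g. *)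
Theorem generator_onto (c : R) : parallelogram R V -> 0 < c ->
  (forall f w, K f -> has_generator f w -> c * `|f| <= `|w|) ->
  forall x, K x -> exists2 f, K f & has_generator f x.
Proof.
move=> para c0 Lc x Kx.
have gen0 g : (forall t : R, 0 < t -> T t g = g) -> has_generator g 0.
  move=> Tg; apply: integrated_has_generator => t e t0 ge.
  have e0 : 0 <= e by apply: le_trans (ge 0 _); rewrite ?normr_ge0// lexx.
  move: t0; rewrite le_eqVlt => /predU1P[<-|t0].
    by rewrite T0 subrr scaler0 subrr normr0 mul0r.
  by rewrite Tg// subrr scaler0 subrr normr0 mulr_ge0// ltW.
have gen00 : has_generator 0 0 by apply: gen0 => t _; rewrite linear0.
have [||||||f [Kf fx]] := @closed_relation_onto R V para K
    (fun f w => K f /\ has_generator f w) c c0 _ _ _ _ KD _ _ x Kx;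
  last by exists f.
- by move=> f w [Kf]; exact: generator_in.
- move=> a f w f' w' [Kf fw] [Kf' fw']; split; first exact: Klin.
  exact: has_generator_linear.
- by [].
- move=> u v f w uv uf vw; split.
    apply: (closed_cvg K Kcl _ _ uf); near=> n; exact: (uv n).1.
  apply: integrated_has_generator; apply: integrated_closed uf vw _ => n.
  by apply: has_generator_integrated; exact: (uv n).2.
- by move=> f w [Kf]; exact: Lc.
- move=> g Kg gmin; split => //; apply: gen0 => t t0.
  apply: (contraction_fix R V para) => //.
  have [f Kf fw] := increment_in_range _ _ t0 Kg.
  apply: (gmin (2^-1 *: f)); split; first exact: KZ.
  by have := has_generator_linear 2^-1 _ _ _ _ fw gen00; rewrite !addr0.
Unshelve. all: by end_near. Qed.

End invariant_subspace.
End contraction_semigroup.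

(** * The range of P - I for a contraction P *)

Section contraction.
Context (R : realType) (V : completeNormedModType R).

(** [closed_relation_onto] for T - I: if g is shortest in its class, then the
    increment T g - g, halved, is available as a competitor. *)
Theorem contraction_onto (T : {linear V -> V}) (K : set V) (c : R) :
  parallelogram R V -> (forall x, `|T x| <= `|x|) ->
  closed K -> K 0 -> (forall a x y, K x -> K y -> K (a *: x + y)) ->
  (forall x, K x -> K (T x)) ->
  0 < c -> (forall f, K f -> c * `|f| <= `|T f - f|) ->
  forall x, K x -> exists2 f, K f & T f - f = x.
Proof.
move=> para T_le Kcl K0 Klin KT c0 Tc x Kx.
have KD u v : K u -> K v -> K (u + v).
  by move=> Ku Kv; rewrite -[u]scale1r; exact: Klin.
have KZ a u : K u -> K (a *: u).
  by move=> Ku; rewrite -[_ *: _]addr0; exact: Klin.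
have [||||||f [Kf fx]] := closed_relation_onto R V para K
    (fun f w => K f /\ T f - f = w) c c0 _ _ _ _ KD _ _ x Kx;
  last by exists f.
- by move=> f w [Kf <-]; rewrite addrC -scaleN1r; apply: Klin => //; exact: KT.
- move=> a f w f' w' [Kf <-] [Kf' <-]; split; first exact: Klin.
  by rewrite linearP opprD addrACA scalerBr.
- by rewrite linear0 subrr.
- move=> u v f w uv uf vw; split.
    apply: (closed_cvg K Kcl _ _ uf); near=> n; exact: (uv n).1.
  have Tuf : T (u n) @[n --> \oo] --> T f.
    apply/cvgrPdist_le => e e0; near=> n.
    rewrite -linearB (le_trans (T_le _))//; near: n.
    exact: (cvgrPdist_le _ _).1 uf _ e0.
  have : (T (u n) - u n) @[n --> \oo] --> T f - f by exact: cvgB.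
  under eq_fun do rewrite (uv _).2.
  move=> vTf; exact: (cvg_unique _ vTf vw).
- by move=> f w [Kf <-]; exact: Tc.
- move=> g Kg gmin; split => //; apply/eqP; rewrite subr_eq0; apply/eqP.
  apply: (contraction_fix R V para) => //; apply: (gmin (2^-1 *: g)).
  by split; [exact: KZ|rewrite linearZ scalerBr].
Unshelve. all: by end_near. Qed.

End contraction.

(** * L^2 as a real normed space *)

Section real_L2.
Import ComplexField.Normc.
Local Open Scope complex_scope.
Local Open Scope quotient_scope.
Context d (S : measurableType d) (R : realType).
Variable mu : {measure set S -> \bar R}.

(** A separate name for the type, because [L2 mu] already carries a normed
    module structure, over R[i]. *)
Definition L2R : Type := L2 mu.
HB.instance Definition _ := GRing.Zmodule.on L2R.

Definition L2R_scale (a : R) (u : L2R) : L2R := a%:C *: (u : L2 mu).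

Fact L2R_scaleA a b u : L2R_scale a (L2R_scale b u) = L2R_scale (a * b) u.
Proof. by rewrite /L2R_scale scalerA rmorphM. Qed.

Fact L2R_scale1 : left_id 1 L2R_scale.
Proof. by move=> u; rewrite /L2R_scale scale1r. Qed.

Fact L2R_scaleDr : right_distributive L2R_scale +%R.
Proof. by move=> a u v; rewrite /L2R_scale -scalerDr. Qed.

Fact L2R_scaleDl u : {morph L2R_scale^~ u : a b / a + b}.
Proof. by move=> a b; rewrite /L2R_scale rmorphD -scalerDl. Qed.

HB.instance Definition _ := GRing.Zmodule_isLmodule.Build R L2R
  L2R_scaleA L2R_scale1 L2R_scaleDr L2R_scaleDl.

Definition L2R_norm (u : L2R) : R := L2norm u.

Fact L2R_normD u v : L2R_norm (u + v) <= L2R_norm u + L2R_norm v.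
Proof. by have := L2normD u v; rewrite -rmorphD lecR. Qed.

Fact L2R_normZ a u : L2R_norm (a *: u) = `|a| * L2R_norm u.
Proof.
have := L2normZ a%:C u; rewrite normc_def /= expr0n addr0 sqrtr_sqr -rmorphM.
by case.
Qed.

Fact L2R_norm_eq0 u : L2R_norm u = 0 -> u = 0.
Proof. by rewrite /L2R_norm => u0; apply: L2norm_eq0; rewrite u0. Qed.

HB.instance Definition _ := Lmodule_isNormed.Build R L2R
  L2R_normD L2R_normZ L2R_norm_eq0.

Lemma L2R_normE (u : L2R) : `|u| = L2norm u.
Proof. by []. Qed.

Lemma L2R_scaleE (a : R) (u : L2R) : a *: u = (a%:C *: (u : L2 mu)).
Proof. by []. Qed.

Lemma L2R_norm_sqr (F : L2fun mu) :
  ((L2norm (\pi_(L2 mu) F)) ^+ 2)%:E = (\int[mu]_x ((normc (F x)) ^+ 2)%:E)%E.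
Proof.
have i0 : (0 <= \int[mu]_x ((normc (F x)) ^+ 2)%:E)%E.
  by apply: integral_ge0 => x _; rewrite lee_fin sqr_ge0.
transitivity ((L2norm (\pi_(L2 mu) F))%:E `^ 2)%E.
  by rewrite poweR_EFin powR_mulrn// L2norm_ge0.
by rewrite L2norm_piE eL2normE -poweRrM mulVf// poweRe1.
Qed.

Lemma L2fun_sqr (f : S -> R[i]) : cmeasurable f ->
  f \in L2fun_pred mu = (\int[mu]_x ((normc (f x)) ^+ 2)%:E < +oo)%E.
Proof.
move=> mf; apply/idP/idP => [fL|flt].
  by rewrite (_ : f = MkL2fun fL)// -L2R_norm_sqr ltry.
apply/L2fun_predP; split => //; rewrite eL2normE.
rewrite lt_neqAle leey andbT; apply/eqP => /poweR_eqy h.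
by rewrite h ltxx in flt.
Qed.

Lemma cmeasurable_sqr (f : S -> R[i]) : cmeasurable f ->
  measurable_fun setT (fun x => ((normc (f x)) ^+ 2)%:E).
Proof.
by move=> mf; apply/measurable_EFinP/measurable_funX/cmeasurable_normc.
Qed.

Lemma normc_sqr (z : R[i]) :
  normc z ^+ 2 = complex.Re z ^+ 2 + complex.Im z ^+ 2.
Proof. by rewrite normcE2 sqr_sqrtr// addr_ge0 ?sqr_ge0. Qed.

Lemma L2R_parallelogram : parallelogram R L2R.
Proof.
move=> u v; rewrite !L2R_normE.
elim/quotW: u => F; elim/quotW: v => G.
have -> : (\pi_(L2 mu) F : L2R) + \pi_(L2 mu) G = \pi_(L2 mu) (F + G).
  by rewrite L2_piD.
have -> : (\pi_(L2 mu) F : L2R) - \pi_(L2 mu) G = \pi_(L2 mu) (F - G).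
  by rewrite !piE.
have [mF _] := L2funP F; have [mG _] := L2funP G.
have [mFG _] := L2funP (F + G); have [mFG' _] := L2funP (F - G).
apply: EFin_inj; rewrite EFinM !EFinD !L2R_norm_sqr.
have nn f x : (0 <= ((normc (f x : R[i])) ^+ 2)%:E)%E.
  by rewrite lee_fin sqr_ge0.
rewrite -!ge0_integralD// -?ge0_integralZl//;
  try exact: cmeasurable_sqr; last first.
- by rewrite adde_ge0.
- by move=> x _; rewrite adde_ge0.
- by apply: emeasurable_funD; exact: cmeasurable_sqr.
apply: eq_integral => x _; rewrite -!EFinD -EFinM; congr (_%:E).
rewrite !normc_sqr -[(F + G) x]/(F x + G x) -[(F - G) x]/(F x - G x).
by case: (F x) (G x) => a b [a' b'] /=; ring.
Qed.

End real_L2.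

Arguments L2R {d S R} mu.

(** * Completeness of L^2 *)

Section riesz_fischer.
Import ComplexField.Normc.
Local Open Scope complex_scope.
Local Open Scope quotient_scope.
Context d (S : measurableType d) (R : realType) (mu : probability S R).

Lemma L2_piB (F G : L2fun mu) :
  (\pi_(L2 mu) F : L2R mu) - \pi_(L2 mu) G = \pi_(L2 mu) (F - G).
Proof. by rewrite !piE. Qed.

(** Integrate a <= a^2 / (2 c) + c / 2 against the probability [mu]. *)
Lemma L2fun_L1_le (F : L2fun mu) (c : R) : 0 < c ->
  L2norm (\pi_(L2 mu) F) <= c -> (\int[mu]_x (normc (F x))%:E <= c%:E)%E.
Proof.
move=> c0 Fc; have [mF _] := L2funP F.
have le1 : (\int[mu]_x (normc (F x))%:E <=
    \int[mu]_x ((c *+ 2)^-1%:E * ((normc (F x)) ^+ 2)%:E + (c / 2)%:E))%E.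
  apply: ge0_le_integral => //.
  - by move=> x _; rewrite lee_fin normc_ge0.
  - by apply/measurable_EFinP/cmeasurable_normc.
  - apply: emeasurable_funD => //; apply: emeasurable_funM => //.
    exact: cmeasurable_sqr.
  - move=> x _; rewrite -EFinM -EFinD lee_fin.
    move: (normc (F x)) => a.
    rewrite -subr_ge0 (_ : _ - a = (c *+ 2)^-1 * (a - c) ^+ 2).
      by rewrite mulr_ge0 ?sqr_ge0// invr_ge0 mulrn_wge0// ltW.
    by field; rewrite ?mulrn_eq0 gt_eqF.
apply: le_trans le1 _; rewrite ge0_integralD//; last 3 first.
- move=> x _; rewrite mule_ge0// lee_fin ?sqr_ge0// invr_ge0.
  by rewrite mulrn_wge0// ltW.
- by apply: emeasurable_funM => //; exact: cmeasurable_sqr.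
- by move=> x _; rewrite lee_fin divr_ge0// ltW.
rewrite ge0_integralZl//; last 3 first.
- exact: cmeasurable_sqr.
- by move=> x _; rewrite lee_fin sqr_ge0.
- by rewrite lee_fin invr_ge0 mulrn_wge0// ltW.
have mu1 : (mu : {measure set S -> \bar R}) setT = 1%E.
  exact: probability_setT.
rewrite integral_cst// mu1 mule1 -L2R_norm_sqr -EFinM -EFinD lee_fin.
have : L2norm (\pi_(L2 mu) F) ^+ 2 <= c ^+ 2.
  by rewrite ler_sqr ?nnegrE ?L2norm_ge0// ltW.
rewrite -(ler_pM2l (x := (c *+ 2)^-1)) ?invr_gt0 ?mulrn_wgt0// => h.
rewrite [leRHS](_ : c = (c *+ 2)^-1 * c ^+ 2 + c / 2).
  by rewrite lerD2r.
by field; rewrite ?mulrn_eq0 gt_eqF.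
Qed.

Lemma limn_einf_le (u : (\bar R)^nat) c N :
  (forall n, (N <= n)%N -> (u n <= c)%E) -> (limn_einf u <= c)%E.
Proof.
move=> uc; rewrite limn_einf_lim; apply: lime_le; first exact: is_cvg_einfs.
near=> k; apply: (@le_trans _ _ (u (maxn N k))); last first.
  by apply: uc; exact: leq_maxl.
by apply: ereal_inf_lbound; exists (maxn N k) => //=; exact: leq_maxr.
Unshelve. all: by end_near. Qed.

Lemma measurable_limn_einf (f : nat -> S -> \bar R) :
  (forall n, measurable_fun setT (f n)) ->
  measurable_fun setT (fun x => limn_einf (f ^~ x)).
Proof.
move=> mf; under eq_fun do rewrite -[limn_einf _]oppeK -limn_esupN.
apply: measurableT_comp => //.
by apply: measurable_fun_limn_esup => n; exact: measurableT_comp.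
Qed.

(** A total, measurable stand-in for the limit of a real sequence: it is the
    limit when the sequence converges. *)
Definition elimsup (u : R^nat) : R := fine (limn_esup (EFin \o u)).

Lemma cvg_elimsup (u : R^nat) : cvgn u -> u n @[n --> \oo] --> elimsup u.
Proof.
move=> /cvg_ex[l ul]; rewrite /elimsup.
have /cvg_limn_einf_sup[_ ->] : (EFin \o u) n @[n --> \oo] --> l%:E.
  by apply: cvg_EFin => //; exact: nearW.
exact: ul.
Qed.

Lemma measurable_elimsup (f : nat -> S -> R) :
  (forall n, measurable_fun setT (f n)) ->
  measurable_fun setT (fun x => elimsup (f ^~ x)).
Proof.
have mfine := fine_measurable (measurableT : measurable [set: \bar R]).
move=> mf; apply: (measurableT_comp mfine) => //.
by apply: measurable_fun_limn_esup => n; exact/measurable_EFinP.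
Qed.

Lemma cvgn_of_increments (u v : R^nat) (M : R) :
  (forall n, `|u n.+1 - u n| <= v n) ->
  (forall n, \sum_(0 <= k < n) v k <= M) -> cvgn u.
Proof.
move=> uv vM.
have v0 n : 0 <= v n by apply: le_trans (uv n).
have vcvg : cvgn (series v).
  apply: nondecreasing_is_cvgn; last by exists M => _ [n _ <-]; exact: vM.
  by apply: nondecreasing_series => n _ _; exact: v0.
rewrite (_ : u = (fun n => u 0%N + series (telescope u) n)); last first.
  by apply/funext => n; exact: eq_sum_telescope.
apply: is_cvgD; first exact: is_cvg_cst.
apply: normed_cvg.
apply: (@series_le_cvg R (fun n => `|telescope u n|) v) vcvg => n //.
exact: uv.
Qed.

Lemma normc_ge_Re (z : R[i]) : `|complex.Re z| <= normc z.
Proof. by case: z => a b /=; rewrite -sqrtr_sqr ler_wsqrtr// lerDl sqr_ge0. Qed.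

Lemma normc_ge_Im (z : R[i]) : `|complex.Im z| <= normc z.
Proof. by case: z => a b /=; rewrite -sqrtr_sqr ler_wsqrtr// lerDr sqr_ge0. Qed.

(** The increments |F_{n+1} - F_n| are summable in L^1, as L^1 norms are at most
    L^2 norms, so their sum is finite almost everywhere. *)
Lemma riesz_fischer_ae (F : nat -> L2fun mu) :
  (forall n m, (n <= m)%N ->
    L2norm (\pi_(L2 mu) (F m - F n)) <= (2 ^ n.+1)%:R^-1) ->
  {ae mu, forall x, cvgn (fun n => complex.Re (F n x)) /\
                    cvgn (fun n => complex.Im (F n x))}.
Proof.
move=> FC.
pose D n x : \bar R := (normc (F n.+1 x - F n x))%:E.
have mD n : measurable_fun setT (D n).
  apply/measurable_EFinP; apply: (@cmeasurable_normc _ _ _ (F n.+1 - F n)).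
  by have [] := L2funP (F n.+1 - F n).
have D0 n x : (0 <= D n x)%E by rewrite lee_fin normc_ge0.
have intD : (\int[mu]_x (\sum_(n <oo) D n x) < +oo)%E.
  rewrite integral_nneseries//.
  apply: (@le_lt_trans _ _ 1%:E); last exact: ltry.
  apply: le_trans (epsilon_trick0 xpredT (ler01 : 0 <= 1 :> R)).
  apply: lee_nneseries => [i _ _|n _]; first exact: integral_ge0.
  rewrite div1r; apply: (L2fun_L1_le (F n.+1 - F n)); last exact: FC.
  by rewrite invr_gt0 ltr0n expn_gt0.
have : mu.-integrable setT (fun x => \sum_(n <oo) D n x)%E.
  apply/integrableP; split; first exact: ge0_emeasurable_sum.
  under eq_integral do rewrite gee0_abs ?nneseries_ge0//.
  exact: intD.
move/(integrable_ae measurableT); apply: filterS => x /(_ I) fx.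
have bnd n : \sum_(0 <= k < n) normc (F k.+1 x - F k x) <=
    fine (\sum_(k <oo) D k x)%E.
  rewrite -lee_fin fineK// -sumEFin.
  by apply: nneseries_lim_ge => k _ _; exact: D0.
by split; apply: (cvgn_of_increments _ _ _ _ bnd) => n; rewrite -raddfB;
  [exact: normc_ge_Re|exact: normc_ge_Im].
Qed.

(** The limit is taken pointwise, and Fatou's lemma turns the bounds on
    F_m - F_n into bounds on the limit minus F_n. *)
Lemma riesz_fischer (F : nat -> L2fun mu) :
  (forall n m, (n <= m)%N ->
    L2norm (\pi_(L2 mu) (F m - F n)) <= (2 ^ n.+1)%:R^-1) ->
  exists G : L2fun mu, forall n,
    L2norm (\pi_(L2 mu) (G - F n)) <= (2 ^ n.+1)%:R^-1.
Proof.
move=> FC.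
have mF n := (L2funP (F n)).1.
pose g x : R[i] := elimsup (fun n => complex.Re (F n x)) +i*
                   elimsup (fun n => complex.Im (F n x)).
have mg : cmeasurable g.
  by split; apply: measurable_elimsup => n; have [] := mF n.
have mgF n : cmeasurable (g - F n).
  have -> : g - F n = (-1) *: (F n : S -> R[i]) + g by rewrite scaleN1r addrC.
  exact: cmeasurable_lin.
have gF n : (\int[mu]_x ((normc ((g - F n) x)) ^+ 2)%:E <=
    (((2 ^ n.+1)%:R^-1) ^+ 2)%:E)%E.
  have mFF m :
      measurable_fun setT (fun x => ((normc ((F m - F n) x)) ^+ 2)%:E).
    by apply: cmeasurable_sqr; have [] := L2funP (F m - F n).
  have -> : (\int[mu]_x ((normc ((g - F n) x)) ^+ 2)%:E =
      \int[mu]_x limn_einf (fun m => ((normc ((F m - F n) x)) ^+ 2)%:E))%E.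
    apply: ae_eq_integral => //.
    - exact: cmeasurable_sqr.
    - exact: measurable_limn_einf.
    have := riesz_fischer_ae F FC; apply: filterS => x [cr ci] _.
    have cvg1 : ((normc ((F m - F n) x)) ^+ 2)%:E @[m --> \oo] -->
        ((normc ((g - F n) x)) ^+ 2)%:E.
      apply: cvg_EFin; first by near=> m.
      rewrite /= normc_sqr; under eq_fun do rewrite /= normc_sqr.
      have cvg2 (u : R^nat) (l c : R) : u m @[m --> \oo] --> l ->
          (u m - c) ^+ 2 @[m --> \oo] --> (l - c) ^+ 2.
        move=> ul; rewrite expr2; under eq_fun do rewrite expr2.
        have h : (u m - c) @[m --> \oo] --> l - c.
          by apply: cvgB => //; exact: cvg_cst.
        exact: cvgM.
      have ReB z z' : complex.Re (z - z') = complex.Re z - complex.Re z' :> R.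
        by rewrite raddfB.
      have ImB z z' : complex.Im (z - z') = complex.Im z - complex.Im z' :> R.
        by rewrite raddfB.
      apply: cvgD.
        under eq_fun do rewrite ReB.
        rewrite ReB; apply: cvg2; exact: cvg_elimsup cr.
      under eq_fun do rewrite ImB.
      rewrite ImB; apply: cvg2; exact: cvg_elimsup ci.
    by have [->] := cvg_limn_einf_sup cvg1.
  apply: le_trans (fatou mu measurableT mFF _) _.
    by move=> m x _; rewrite lee_fin sqr_ge0.
  apply: (@limn_einf_le _ _ n) => m nm.
  rewrite -L2R_norm_sqr lee_fin ler_sqr ?nnegrE ?L2norm_ge0//.
  exact: FC.
have gFL n : g - F n \in L2fun_pred mu.
  by rewrite L2fun_sqr//; apply: le_lt_trans (gF n) _; exact: ltry.
have gL : g \in L2fun_pred mu.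
  rewrite -(subrK (F 0%N : S -> R[i]) g) rpredD //; [exact: gFL|exact: valP].
exists (MkL2fun gL) => n.
rewrite -(ler_sqr (x := L2norm _)) ?nnegrE ?L2norm_ge0// -lee_fin L2R_norm_sqr.
exact: gF.
Unshelve. all: by end_near. Qed.

Fact L2R_cauchy_cvg (F : set_system (L2R mu)) :
  ProperFilter F -> cauchy F -> cvg F.
Proof.
move=> FF /cauchyP Fc.
pose r n : R := (2 ^ n.+2)%:R^-1.
have r0 n : 0 < r n by rewrite invr_gt0 ltr0n expn_gt0.
(* centres of balls of F whose radii r n are small enough for the rate that
   the sequential statement requires *)
have /choice[f fP] n :
    exists f : L2fun mu, F (ball (\pi_(L2 mu) f : L2R mu) (r n)).
  by have [x] := Fc _ (r0 n); rewrite -[x]reprK; exists (repr x).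
have r2 n : r n *+ 2 = (2 ^ n.+1)%:R^-1.
  by rewrite /r expnS natrM invfM -[LHS]mulr_natl mulVKf.
have rle n m : (n <= m)%N -> r m <= r n.
  move=> nm; rewrite lef_pV2 ?posrE ?ltr0n ?expn_gt0//.
  by rewrite ler_nat leq_exp2l// !ltnS.
have [|g gP] := riesz_fischer f.
  move=> n m nm; rewrite -L2R_normE -L2_piB.
  have [x [fmx fnx]] := filter_ex (filterI (fP m) (fP n)).
  move: fmx fnx; rewrite -!ball_normE /= => fmx fnx.
  rewrite -r2 mulr2n; apply: le_trans (ler_distD x _ _) _.
  by rewrite (lerD (le_trans (ltW fmx) (rle _ _ nm)))// distrC ltW.
apply/cvg_ex; exists (\pi_(L2 mu) g : L2R mu).
apply/cvgrPdist_lt => e e0.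
have [n rn] : exists n, r n *+ 3 < e.
  have [n _ /(_ _ (leqnn n)) /= ne] := near_infty_natSinv_expn_lt (PosNum e0).
  exists n; apply: lt_trans ne; rewrite /r !expnS !natrM natrX mulrA invfM.
  have : 0 < (2 ^+ n)^-1 :> R by rewrite invr_gt0 exprn_gt0.
  by rewrite div1r -mulr_natl; lra.
apply: filterS (fP n) => x; rewrite -ball_normE /= => fnx.
apply: le_lt_trans (ler_distD (\pi_(L2 mu) (f n) : L2R mu) _ _) _.
apply: lt_trans rn; rewrite mulrSr; apply: ler_ltD fnx.
by rewrite L2_piB L2R_normE r2.
Qed.

HB.instance Definition _ := Uniform_isComplete.Build (L2R mu) L2R_cauchy_cvg.
End riesz_fischer.

(** * Invariant Markov kernels act on L^2 as contractions *)

Section markov_operator.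
Import ComplexField.Normc.
Local Open Scope complex_scope.
Local Open Scope quotient_scope.
Context d (S : measurableType d) (R : realType) (mu : probability S R).
Variable k : R.-pker S ~> S.
Hypothesis kmu : invariant_kernel mu k.

Lemma measurable_kernel_sqr (F : L2fun mu) :
  measurable_fun setT (fun x => \int[k x]_y ((normc (F y)) ^+ 2)%:E)%E.
Proof.
apply: (measurable_fun_integral_finite_kernel
  (fun z : S * S => ((normc (F z.2)) ^+ 2)%:E) k) => //.
  by move=> z; rewrite lee_fin sqr_ge0.
have mF2 : measurable_fun setT (fun x => ((normc (F x)) ^+ 2)%:E).
  by apply: cmeasurable_sqr; case: (L2funP F).
exact: (measurableT_comp mF2).
Qed.

Lemma integral_kernel_sqr (F : L2fun mu) :
  (\int[mu]_x \int[k x]_y ((normc (F y)) ^+ 2)%:E =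
   ((L2norm (\pi_(L2 mu) F)) ^+ 2)%:E)%E.
Proof.
rewrite L2R_norm_sqr; apply: invariant_integral => //.
  by apply: cmeasurable_sqr; case: (L2funP F).
by move=> x; rewrite lee_fin sqr_ge0.
Qed.

(** Invariance makes the integral of |F|^2 against k x finite for almost every
    x, and |F| <= 1 + |F|^2. *)
Lemma kernel_integrable_ae (F : L2fun mu) : {ae mu, forall x,
  (k x).-integrable setT (fun y => (complex.Re (F y))%:E) /\
  (k x).-integrable setT (fun y => (complex.Im (F y))%:E)}.
Proof.
have [[mr mi] _] := L2funP F.
have sqr0 x : (0 <= \int[k x]_y ((normc (F y)) ^+ 2)%:E)%E.
  by apply: integral_ge0 => y _; rewrite lee_fin sqr_ge0.
have : mu.-integrable setT (fun x => \int[k x]_y ((normc (F y)) ^+ 2)%:E)%E.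
  apply/integrableP; split; first exact: measurable_kernel_sqr.
  under eq_integral do rewrite gee0_abs//.
  by rewrite integral_kernel_sqr ltry.
move/(integrable_ae measurableT); apply: filterS => x /(_ I) fx.
have int1 : (k x).-integrable setT (fun y => (1 + (normc (F y)) ^+ 2)%:E).
  under eq_fun do rewrite EFinD; apply: integrableD => //.
    apply/integrableP; split; first exact: measurable_cst.
    by rewrite integral_cst//= prob_kernel mule1 normr1 ltry.
  apply/integrableP; split; first exact/cmeasurable_sqr.
  under eq_integral do rewrite gee0_abs ?lee_fin ?sqr_ge0//.
  by rewrite ltey_eq fx.
have le1 (a b : R) : `|a| <= b -> `|a| <= `|1 + b ^+ 2|.
  move=> ab; rewrite [leRHS]ger0_norm ?addr_ge0 ?sqr_ge0//.
  by have := normr_ge0 a; nra.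
split; apply: le_integrable int1 => //; try exact/measurable_EFinP;
  move=> y _; rewrite /= lee_fin; apply: le1;
  [exact: normc_ge_Re|exact: normc_ge_Im].
Qed.

Lemma kernel_fun_linear_ae (a : R) (F G : L2fun mu) : {ae mu, forall x,
  kernel_fun k (a%:C *: F + G : L2fun mu) x =
  a%:C * kernel_fun k F x + kernel_fun k G x}.
Proof.
apply: filterS2 (kernel_integrable_ae F) (kernel_integrable_ae G).
move=> x [Fr Fi] [Gr Gi]; rewrite /kernel_fun /cRintegral.
have E y : (a%:C *: F + G : L2fun mu) y = a%:C * F y + G y by [].
have -> : \int[k x]_y complex.Re ((a%:C *: F + G : L2fun mu) y) =
    \int[k x]_y (a * complex.Re (F y) + complex.Re (G y)).
  apply: eq_Rintegral => y _; rewrite E.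
  by case: (F y) (G y) => ? ? [? ?] /=; ring.
have -> : \int[k x]_y complex.Im ((a%:C *: F + G : L2fun mu) y) =
    \int[k x]_y (a * complex.Im (F y) + complex.Im (G y)).
  apply: eq_Rintegral => y _; rewrite E.
  by case: (F y) (G y) => ? ? [? ?] /=; ring.
have aint (f : S -> R) : (k x).-integrable setT (EFin \o f) ->
    (k x).-integrable setT (EFin \o (fun y => a * f y)).
  by move=> fi; apply: (integrableZl measurableT a) fi.
rewrite !RintegralD ?RintegralZl//; try exact: aint.
by apply/eqP; rewrite eq_complex /=; apply/andP; split; apply/eqP; ring.
Qed.

Definition markov_op (u : L2R mu) : L2R mu := kernel_op k u.

Fact markov_op_linear : linear markov_op.
Proof.
move=> a; elim/quotW => F; elim/quotW => G.
have -> : a *: (\pi_(L2 mu) F : L2R mu) + \pi_(L2 mu) G =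
    \pi_(L2 mu) (a%:C *: F + G).
  by rewrite L2_piD L2_piZ.
rewrite /markov_op !(kernel_op_pi _ kmu) L2R_scaleE -L2_piZ -L2_piD.
apply: L2_eq; exact: kernel_fun_linear_ae.
Qed.

Definition markov_linear : {linear L2R mu -> L2R mu} :=
  HB.pack markov_op
    (GRing.isLinear.Build R (L2R mu) (L2R mu) _ markov_op markov_op_linear).

(** Jensen's inequality under each k x, then invariance. *)
Lemma markov_op_le u : `|markov_op u| <= `|u|.
Proof.
elim/quotW: u => F; rewrite /markov_op (kernel_op_pi _ kmu) !L2R_normE.
rewrite -ler_sqr ?nnegrE ?L2norm_ge0// -lee_fin.
rewrite -(integral_kernel_sqr F) L2R_norm_sqr.
have [mF _] := L2funP F.
have [mkF _] := L2funP (MkL2fun (kernel_fun_L2 F kmu)).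
apply: ge0_le_integral => //.
- by move=> x _; rewrite lee_fin sqr_ge0.
- exact: cmeasurable_sqr.
- exact: measurable_kernel_sqr.
move=> x _; rewrite normc_sqr EFinD.
under eq_integral do rewrite normc_sqr EFinD.
have [mr mi] := mF.
rewrite ge0_integralD//; last 4 first.
- by move=> y _; rewrite lee_fin sqr_ge0.
- by apply/measurable_EFinP/measurable_funX.
- by move=> y _; rewrite lee_fin sqr_ge0.
- by apply/measurable_EFinP/measurable_funX.
by apply: leeD; apply: sqr_Rintegral_le => //; exact: prob_kernel.
Qed.

End markov_operator.
Arguments markov_linear {d S R mu k} kmu.

(** * Minimum modulus and inverses *)

Section transfer.
Import ComplexField.Normc.
Local Open Scope complex_scope.
Local Open Scope quotient_scope.
Context d (S : measurableType d) (R : realType) (mu : probability S R).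

Lemma L2_cvgP (T : Type) (F : set_system T) (FF : Filter F) (f : T -> L2 mu)
    (u : L2 mu) :
  (f x @[x --> F] --> u) <-> ((f x : L2R mu) @[x --> F] --> (u : L2R mu)).
Proof.
split=> fu; apply/cvgrPdist_lt => e e0.
  have e0' : 0 < e%:C by rewrite ltcR.
  near=> x; rewrite -ltcR; near: x.
  exact: (cvgrPdist_lt _ _).1 fu _ e0'.
have [er ei] : 0 < complex.Re e /\ complex.Im e = 0.
  by case: e e0 => a b; rewrite ltcE /= => /andP[/eqP -> ->].
near=> x; rewrite L2_normE ltcE /= ei eqxx /=; near: x.
exact: (cvgrPdist_lt _ _).1 fu _ er.
Unshelve. all: by end_near. Qed.

Lemma L2_closed (K : set (L2 mu)) : closed K -> closed (K : set (L2R mu)).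
Proof.
move=> Kcl x xK; apply: Kcl => B xB; apply: xK.
have /L2_cvgP : (y : L2R mu) @[y --> (x : L2R mu)] --> (x : L2R mu).
  exact: cvg_id.
exact.
Qed.

(** The infinite value is kept apart: it occurs exactly when the infimum runs
    over the empty set, and then any positive c is a lower bound. *)
Lemma minimum_modulusP (D : set (L2 mu)) (A : L2 mu -> L2 mu) :
  (0 < minimum_modulus D A)%E ->
  exists2 c : R, 0 < c & (forall f, D f -> c * L2norm f <= L2norm (A f)) /\
   (minimum_modulus D A = c%:E \/
    (minimum_modulus D A = +oo%E /\ D `<=` [set 0])).
Proof.
move=> g0.
have norm0 : L2norm (0 : L2 mu) = 0.
  by rewrite -[L2norm _]/(`|0 : L2R mu|) normr0.
have lb f : D f -> f != 0 ->
    (minimum_modulus D A <= (L2norm (A f) / L2norm f)%:E)%E.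
  move=> Df f0; apply: ereal_inf_lbound; exists f => //.
  by split => //; exact/eqP.
have [gy|gfin] := eqVneq (minimum_modulus D A) +oo%E.
  have D0 : D `<=` [set 0].
    move=> f Df; apply/eqP/negP => /negP f0.
    by have := lb f Df f0; rewrite gy leye_eq.
  exists 1 => //; split; last by right.
  by move=> f /D0 ->; rewrite norm0 mulr0 L2norm_ge0.
have gE : minimum_modulus D A = (fine (minimum_modulus D A))%:E.
  by rewrite fineK// fin_numElt ltey gfin andbT (lt_trans _ g0).
exists (fine (minimum_modulus D A)); first by rewrite -lte_fin -gE.
split; last by left.
move=> f Df; have [->|f0] := eqVneq f 0.
  by rewrite norm0 mulr0 L2norm_ge0.
have nf0 : 0 < L2norm f.
  rewrite -[L2norm f]/(`|f : L2R mu|) normr_gt0; exact: f0.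
by have := lb f Df f0; rewrite [X in (X <= _)%E]gE lee_fin ler_pdivlMr.
Qed.

(** Only surjectivity has to be supplied; the lower bound gives injectivity and
    the norm of the inverse. *)
Lemma invertible_of_onto (D K : set (L2 mu)) (A : L2 mu -> L2 mu) :
  set_fun D K A ->
  (forall f f', D f -> D f' -> D (f - f') /\ A (f - f') = A f - A f') ->
  (0 < minimum_modulus D A)%E ->
  (forall u, K u -> exists2 f, D f & A f = u) ->
  set_bij D K A /\
  exists T : L2 mu -> L2 mu,
    [/\ inverse_on D K A T, bounded_on K T &
        (opnorm_on K T <= (minimum_modulus D A)^-1)%E].
Proof.
move=> DK Dlin /minimum_modulusP[c c0 [Ac gE]] onto.
have inj f f' : D f -> D f' -> A f = A f' -> f = f'.
  move=> Df Df' Aff'; have [Dff' Aff'E] := Dlin _ _ Df Df'.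
  have := Ac _ Dff'; rewrite Aff'E Aff' subrr.
  rewrite -[L2norm 0]/(`|0 : L2R mu|) normr0 pmulr_rle0// => ff'.
  apply/eqP; rewrite -subr_eq0; apply/eqP.
  have : `|f - f' : L2R mu| <= 0 by [].
  by rewrite normr_le0 => /eqP.
pose T u : L2 mu := xget 0 [set f | D f /\ A f = u].
have TP u : K u -> D (T u) /\ A (T u) = u.
  move=> /onto[f Df fu]; rewrite /T.
  by case: xgetP => [g -> //|/(_ f)[]].
have TK : {in K, cancel T A} by move=> u; rewrite inE => /TP[].
have Tle u : K u -> c * L2norm (T u) <= L2norm u.
  by move=> /TP[DT {2}<-]; exact: Ac.
split.
  by split => // f f'; rewrite !inE; exact: inj.
exists T; split.
- split => //; first by move=> u /TP[].
  by move=> f; rewrite inE => Df; apply: inj => //; have [] := TP _ (DK _ Df).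
- by exists c^-1 => u Ku; rewrite ler_pdivlMl// Tle.
apply: ub_ereal_sup => _ [u [Ku u1] <-].
case: gE => [->|[-> D0]].
  rewrite inver gt_eqF// lee_fin -[leRHS]mulr1 ler_pdivlMl//.
  exact: le_trans (Tle _ Ku) u1.
rewrite invey; have [/D0 -> _] := TP _ Ku.
by rewrite -[L2norm _]/(`|0 : L2R mu|) normr0.
Qed.

End transfer.

(** * The generator of stationary dynamics *)

Section generator.
Import ComplexField.Normc.
Local Open Scope complex_scope.
Local Open Scope quotient_scope.
Context d (S : measurableType d) (R : realType) (mu : probability S R).

Lemma discrete_generator_onto (P : R.-pker S ~> S) (K : set (L2 mu)) :
  invariant_kernel mu P -> closed K -> K 0 ->
  (forall (a : R[i]) x y, K x -> K y -> K (a *: x + y)) ->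
  (forall u, K u -> K (kernel_op P u)) ->
  let D := restricted_dom (Discrete P) K in
  let A := generator (Discrete P) : L2 mu -> L2 mu in
  (0 < minimum_modulus D A)%E ->
  [/\ set_fun D K A,
      (forall f f', D f -> D f' -> D (f - f') /\ A (f - f') = A f - A f') &
      (forall u, K u -> exists2 f, D f & A f = u)].
Proof.
move=> Pmu Kcl K0 Klin KP D A g0.
pose P' := markov_linear Pmu.
have KB x y : K x -> K y -> K (x - y).
  by move=> Kx Ky; rewrite addrC -scaleN1r; exact: Klin.
have AE f : A f = (P' f - f : L2R mu) by [].
split.
- by move=> f [_ Kf]; apply: KB => //; exact: KP.
- move=> f f' [_ Kf] [_ Kf']; split; first by split => //; exact: KB.
  by rewrite !AE linearB opprD addrACA -opprD.
have [c c0 [Ac _]] := minimum_modulusP _ _ _ _ _ _ g0.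
move=> u Ku.
have [||||||||f Kf fu] :=
  contraction_onto R (L2R mu) P' K c _ _ _ _ _ _ _ _ u Ku => //.
- exact: L2R_parallelogram.
- by move=> x; exact: markov_op_le.
- exact: L2_closed.
- by move=> a x y; exact: (Klin a%:C).
- by move=> f Kf; exact: Ac.
by exists f.
Qed.

Lemma continuous_generator_onto (P : R -> R.-pker S ~> S) (K : set (L2 mu)) :
  stationary_dynamics mu (Defs.Continuous P) -> closed K -> K 0 ->
  (forall (a : R[i]) x y, K x -> K y -> K (a *: x + y)) ->
  (forall t u, 0 <= t -> K u -> K (kernel_op (P t) u)) ->
  let D := restricted_dom (Defs.Continuous P) K in
  let A := generator (Defs.Continuous P) : L2 mu -> L2 mu in
  (0 < minimum_modulus D A)%E ->
  [/\ set_fun D K A,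
      (forall f f', D f -> D f' -> D (f - f') /\ A (f - f') = A f - A f') &
      (forall u, K u -> exists2 f, D f & A f = u)].
Proof.
move=> [Pmu [P0 PD Pcont]] Kcl K0 Klin KP D A g0.
(* kernels at negative times need not be invariant; with |t| every T t is a
   contraction, and nothing changes for t >= 0 *)
pose T (t : R) := markov_linear (Pmu _ (normr_ge0 t)).
have TE (t : R) u : 0 <= t -> T t u = kernel_op (P t) u.
  by move=> t0; rewrite /T /= /markov_op ger0_norm.
have genP f w : (diff_quotient P f t @[t --> 0^'+] --> (w : L2 mu)) <->
    has_generator R (L2R mu) T f w.
  rewrite L2_cvgP /has_generator.
  split; apply: cvg_trans; apply: near_eq_cvg; near=> t;
    by rewrite L2R_scaleE TE.
have DA f w : D f /\ A f = w <-> K f /\ has_generator R (L2R mu) T f w.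
  rewrite -genP; split=> [[[fc Kf] <-]|[Kf fw]]; first by split.
  by split; [split => //; apply/cvg_ex; exists w|exact: cvg_lim].
have Tcont u : T t u @[t --> 0^'+] --> (u : L2R mu).
  apply: cvg_trans ((L2_cvgP _ _ _ _ _ _ _ _ _).1 (Pcont u)).
  by apply: near_eq_cvg; near=> t; rewrite TE.
have [c c0 [Ac _]] := minimum_modulusP _ _ _ _ _ _ g0.
have Tle t x : `|T t x| <= `|x|.
  by exact: (markov_op_le _ _ _ _ _ (Pmu _ (normr_ge0 t))).
have T0 x : T 0 x = x by rewrite TE// P0.
have TD (s t : R) : 0 <= s -> 0 <= t -> forall x, T (s + t) x = T s (T t x).
  by move=> s0 t0 x; rewrite !TE ?addr_ge0// PD.
have KlinR (a : R) (x y : L2R mu) : K x -> K y -> K (a *: x + y).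
  exact: (Klin a%:C).
have KT (t : R) x : 0 <= t -> K x -> K (T t x).
  by move=> t0 Kx; rewrite TE//; exact: KP.
have DA' f : D f -> has_generator R (L2R mu) T f (A f).
  by move=> Df; have [] := (DA f (A f)).1 (conj Df erefl).
split.
- move=> f Df; apply: (generator_in R (L2R mu) T K) (DA' f Df) => //.
    exact: L2_closed.
  by case: Df.
- move=> f f' Df Df'; apply/DA; split.
    case: Df Df' => _ Kf [_ Kf']; rewrite addrC -scaleN1r; exact: Klin.
  have := has_generator_linear R (L2R mu) T (-1) _ _ _ _
    (DA' f' Df') (DA' f Df).
  by rewrite !scaleN1r ![- _ + _]addrC.
move=> u Ku.
have [|||f Kf fu] := generator_onto R (L2R mu) T Tle T0 TD Tcont
  K _ K0 KlinR KT c _ c0 _ u Ku.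
- exact: L2_closed.
- exact: L2R_parallelogram.
- by move=> f w Kf fw; have [Df <-] := (DA f w).2 (conj Kf fw); exact: Ac.
by have [Df <-] := (DA f u).2 (conj Kf fu); exists f.
Unshelve. all: by end_near. Qed.

End generator.

Theorem lemma2 (d : measure_display) (S : measurableType d) (R : realType)
    (mu : probability S R) (X : markov_dynamics S R) (K : set (L2 mu)) :
  stationary_dynamics mu X ->
  closed K ->
  submod_closed [in K] ->
  K `<=` L2_0 mu ->
  stable_under X K ->
  (0 < minimum_modulus (restricted_dom X K) (generator X))%E ->
  set_bij (restricted_dom X K) K (generator X) /\
  exists T : L2 mu -> L2 mu,
    [/\ inverse_on (restricted_dom X K) K (generator X) T,
        bounded_on K T &
        (opnorm_on K T <=
          (minimum_modulus (restricted_dom X K) (generator X))^-1)%E].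
Proof.
move=> Xmu Kcl [K0 Klin] _ XK g0.
have {}K0 : K 0 by rewrite inE in K0.
have {}Klin (a : R[i]) x y : K x -> K y -> K (a *: x + y).
  by move=> Kx Ky; have := Klin a x y; rewrite !inE; exact.
suff [DK Dlin onto] : [/\ set_fun (restricted_dom X K) K (generator X),
    (forall f f', restricted_dom X K f -> restricted_dom X K f' ->
      restricted_dom X K (f - f') /\
      generator X (f - f') = generator X f - generator X f') &
    (forall u, K u -> exists2 f, restricted_dom X K f & generator X f = u)].
  exact: invertible_of_onto.
case: X Xmu XK g0 => P Xmu XK g0.
  apply: continuous_generator_onto => // t u t0 Ku.
  by apply: (XK t t0); exists u.
by apply: discrete_generator_onto => // u Ku; apply: XK; exists u.
Qed.
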